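(* There exists a Monte Carlo algorithm which, given an $m\times n$ matrix $A$ of rank $r$ over a field $\mathrm{K}$ containing at least $2\min(m,n)(1+\lceil\log_2 m\rceil+\lceil\log_2 n\rceil)$ elements, computes the rank profile matrix of $A$ with running time bounded by $2r^3+(r^2+m+n+|A|)^{1+o(1)}$ field operations in $\mathrm{K}$, where $|A|$ denotes the number of nonzero elements in $A$.
   Context: The rank profile matrix of an $m\times n$ matrix $A$ of rank $r$ is the unique $m\times n$ matrix of rank $r$ with only $r$ nonzero entries, all equal to one, each of whose leading sub-matrices (first $i$ rows and first $j$ columns) has the same rank as the corresponding leading sub-matrix of $A$. A Monte Carlo algorithm is a randomized algorithm whose running time is always within the stated bound and whose output is correct with probability bounded below by a positive constant (e.g. $1/2$). *)

(* Defs.v *)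
From HB Require Import structures.
From mathcomp Require Import all_boot all_order all_algebra.
From mathcomp Require Import all_classical all_reals all_analysis.

Set Implicit Arguments.
Unset Strict Implicit.
Unset Printing Implicit Defensive.

Import Order.TTheory GRing.Theory Num.Theory.

Local Open Scope ring_scope.

(** * Rank profile matrix *)

Definition leading (K : Type) (m n i j : nat) (hi : (i <= m)%N) (hj : (j <= n)%N)
    (A : 'M[K]_(m, n)) : 'M[K]_(i, j) :=
  mxsub (widen_ord hi) (widen_ord hj) A.

Definition supp (K : fieldType) (m n : nat) (A : 'M[K]_(m, n)) :
    {set 'I_m * 'I_n} :=
  [set ij | A ij.1 ij.2 != 0].

Definition is_rank_profile_matrix (K : fieldType) (m n : nat)
    (A E : 'M[K]_(m, n)) : Prop :=
  [/\ \rank E = \rank A,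
      #|supp E| = \rank A,
      forall i j, E i j != 0 -> E i j = 1
    & forall (i j : nat) (hi : (i <= m)%N) (hj : (j <= n)%N),
        \rank (leading hi hj E) = \rank (leading hi hj A)].

(** * Algebraic random access machine

  An algorithm is a finite program that does not depend on the field nor on
  the dimensions of its input.  Its memory consists of arrays of natural
  numbers and arrays of field elements.  Array names are literals, indices are
  computed, and the two kinds of arrays live in separate name spaces.  Field
  elements are opaque: a program acts on them, and learns about them, only
  through the field instructions. *)

Inductive nexp : Type :=
| NLit of nat
| NGet of nat & nexp          (* NGet a i: entry i of array a *)
| NAdd of nexp & nexp
| NSub of nexp & nexp         (* truncated *)
| NMul of nexp & nexp
| NDiv of nexp & nexp.        (* Euclidean quotient *)

Inductive fop : Type := FAdd | FSub | FMul | FDiv.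

(* In every instruction the first array name and index are the destination. *)
Inductive cmd : Type :=
| Skip
| Seq of cmd & cmd
| NSet of nat & nexp & nexp
| FConst of nat & nexp & bool                              (* load 0 or 1 *)
| FCopy of nat & nexp & nat & nexp
| FOp of fop & nat & nexp & nat & nexp & nat & nexp
| FSample of nat & nexp                                    (* random element *)
| FIfZero of nat & nexp & cmd & cmd                        (* zero test *)
| NIf of nexp & cmd & cmd                                  (* true: nonzero *)
| While of nexp & cmd.                                     (* true: nonzero *)

(* [nops] counts the field operations performed so far: arithmetic operations,
   zero tests and random choices, each for 1; [nsmp] counts the random choices
   alone. *)
Record state (K : Type) : Type := State {
  nmem : nat -> nat -> nat;
  fmem : nat -> nat -> K;
  nops : nat;
  nsmp : nat }.

Definition upd (T : Type) (f : nat -> nat -> T) (a i : nat) (x : T) :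
    nat -> nat -> T :=
  fun b j => if (b == a) && (j == i) then x else f b j.

Fixpoint neval (f : nat -> nat -> nat) (e : nexp) : nat :=
  match e with
  | NLit k => k
  | NGet a i => f a (neval f i)
  | NAdd e1 e2 => (neval f e1 + neval f e2)%N
  | NSub e1 e2 => (neval f e1 - neval f e2)%N
  | NMul e1 e2 => (neval f e1 * neval f e2)%N
  | NDiv e1 e2 => (neval f e1 %/ neval f e2)%N
  end.

(* Division by zero has no result, so that it blocks the execution. *)
Definition fop_eval (K : fieldType) (o : fop) (x y : K) : option K :=
  match o with
  | FAdd => Some (x + y)
  | FSub => Some (x - y)
  | FMul => Some (x * y)
  | FDiv => if y == 0 then None else Some (x / y)
  end.

(* [exec tape c s s']: run from s, c terminates in s'.  The k-th random choice
   (counted from 0) returns [tape k]. *)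
Inductive exec (K : fieldType) (tape : nat -> K) :
    cmd -> state K -> state K -> Prop :=
| ExecSkip s : exec tape Skip s s
| ExecSeq c1 c2 s1 s2 s3 :
    exec tape c1 s1 s2 -> exec tape c2 s2 s3 -> exec tape (Seq c1 c2) s1 s3
| ExecNSet a i e f g t q :
    exec tape (NSet a i e) (State f g t q)
      (State (upd f a (neval f i) (neval f e)) g t q)
| ExecFConst a i (b : bool) f g t q :
    exec tape (FConst a i b) (State f g t q)
      (State f (upd g a (neval f i) b%:R) t q)
| ExecFCopy a i a1 i1 f g t q :
    exec tape (FCopy a i a1 i1) (State f g t q)
      (State f (upd g a (neval f i) (g a1 (neval f i1))) t q)
| ExecFOp o a i a1 i1 a2 i2 z f g t q :
    fop_eval o (g a1 (neval f i1)) (g a2 (neval f i2)) = Some z ->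
    exec tape (FOp o a i a1 i1 a2 i2) (State f g t q)
      (State f (upd g a (neval f i) z) t.+1 q)
| ExecFSample a i f g t q :
    exec tape (FSample a i) (State f g t q)
      (State f (upd g a (neval f i) (tape q)) t.+1 q.+1)
| ExecFIfZero a i c1 c2 f g t q s :
    exec tape (if g a (neval f i) == 0 then c1 else c2) (State f g t.+1 q) s ->
    exec tape (FIfZero a i c1 c2) (State f g t q) s
| ExecNIf e c1 c2 s s' :
    exec tape (if neval (nmem s) e != 0%N then c1 else c2) s s' ->
    exec tape (NIf e c1 c2) s s'
| ExecWhileStop e c s :
    neval (nmem s) e = 0%N -> exec tape (While e c) s s
| ExecWhileStep e c s s' s'' :
    neval (nmem s) e <> 0%N ->
    exec tape c s s' -> exec tape (While e c) s' s'' ->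
    exec tape (While e c) s s''.

(** * Input and output

  A matrix is given in sparse form, as the row by row list of its nonzero
  entries: array 0 of naturals holds m, n and |A|, arrays 1 and 2 of naturals
  hold the row and column indices (from 0), and array 0 of field elements holds
  the values.  All other memory cells are initially zero. *)
Definition init_state (K : fieldType) (m n : nat) (A : 'M[K]_(m, n)) : state K :=
  let s := enum (supp A) in
  State
    (fun a => nth 0%N
       (match a with
        | 0 => [:: m; n; #|supp A|]
        | 1 => [seq val ij.1 | ij <- s]
        | 2 => [seq val ij.2 | ij <- s]
        | _ => [::]
        end))
    (fun a => nth 0
       (match a with
        | 0 => [seq A ij.1 ij.2 | ij <- s]
        | _ => [::]
        end))
    0 0.

(* The output is a 0-1 matrix, in the same form but without the values: entry 2
   of array 0 holds the number of ones, arrays 1 and 2 hold their positions. *)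
Definition output (K : fieldType) (m n : nat) (s : state K) : 'M[K]_(m, n) :=
  \matrix_(i, j)
    (has (fun k => (nmem s 1 k == i) && (nmem s 2 k == j))
         (iota 0 (nmem s 0 2)))%:R.

(** * Monte Carlo algorithms *)

(* Random choices are independent and uniform in the finite set of field
   elements listed by S; w lists the indices in S of the first T choices. *)
Definition tape_of (K : fieldType) (S : seq K) (T : nat)
    (w : T.-tuple 'I_(size S)) (k : nat) : K :=
  nth 0 [seq nth 0 S (val i) | i <- w] k.

(* On input A, whatever its random choices, P terminates within [bound] field
   operations, and its output satisfies [correct] with probability at least
   delta.  T is any bound on the number of random choices made, so that the
   T-tuples of choices determine all the executions. *)
Definition monte_carlo (R : realType) (P : cmd) (delta : R)
    (K : fieldType) (S : seq K) (m n : nat) (A : 'M[K]_(m, n))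
    (correct : 'M[K]_(m, n) -> Prop) (bound : R) : Prop :=
  exists T : nat,
    (forall w : T.-tuple 'I_(size S), exists s : state K,
       [/\ exec (tape_of w) P (init_state A) s,
           (nsmp s <= T)%N & (nops s)%:R <= bound]) /\
    delta <=
      #|[set w : T.-tuple 'I_(size S) |
           `[< exists s : state K, exec (tape_of w) P (init_state A) s
                 /\ correct (output m n s) >] ]|%:R
      / #|{: T.-tuple 'I_(size S)}|%:R.

(* Main.v *)
Require Import Defs.
From HB Require Import structures.
From mathcomp Require Import all_boot all_order all_algebra.
From mathcomp Require Import all_classical all_reals all_analysis.
From mathcomp Require Import zify lra.

Set Implicit Arguments.
Unset Strict Implicit.
Unset Printing Implicit Defensive.

Import Order.TTheory GRing.Theory Num.Theory.
Import numFieldNormedType.Exports.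

Local Open Scope ring_scope.

(* Gaussian elimination that takes the rows in order and the leftmost nonzero
   entry of each reduced row as its pivot visits exactly the ones of the rank
   profile matrix.  To run it within the bound, neither the Schur complement
   W = A - A M A nor any reduced row is ever formed: only M, the inverse of the
   pivot submatrix padded with zeros, is stored, and it is updated at each pivot
   by a rank one correction, for 6 s^2 + O(s) operations after s pivots.

   For one random vector x, the sums of A_ij x_j over the dyadic intervals of
   columns are computed beforehand for every row i, with about log n operations
   per nonzero entry.  Row i of W is zero iff, with high probability, (W x)_i is,
   which costs one product with row i of A; if it is not, its leftmost nonzero
   column is found by binary search on dyadic intervals, each test combining s + 1
   stored sums.  A nonzero test is never wrong, so a wrong answer can only make
   the search miss the leftmost column: the pivot found is nonzero whatever x is,
   and at most r pivots are performed.  The run is correct as soon as the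
   r (1 + log n) dyadic sums above the true pivots are nonzero, and each of them
   vanishes with probability at most 1/|S|. *)

(** * Executions *)

Lemma addn_mul2S t x : (t + 2 * (x + 1) = (t + 2 * x).+2)%N.
Proof. by rewrite mulnDr addnA addn2. Qed.

Section Execution.
Variables (K : fieldType) (tape : nat -> K).
Implicit Types (f : nat -> nat -> nat) (g : nat -> nat -> K) (s : state K).

(** Total correctness in continuation style: the postcondition of [Seq] is again a [run], so a
    program is executed symbolically by applying one rule per instruction. *)
Definition run c s (Q : state K -> Prop) : Prop :=
  exists2 s', exec tape c s s' & Q s'.

Lemma run_weaken c s (Q Q' : state K -> Prop) :
  (forall s', Q s' -> Q' s') -> run c s Q -> run c s Q'.
Proof. by move=> QQ' [s' e /QQ' q]; exists s'. Qed.

Lemma run_skip s (Q : state K -> Prop) : Q s -> run Skip s Q.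
Proof. by exists s => //; constructor. Qed.

Lemma run_seq c1 c2 s Q : run c1 s (fun s' => run c2 s' Q) -> run (Seq c1 c2) s Q.
Proof. by case=> s1 e1 [s2 e2 q]; exists s2 => //; apply: ExecSeq e1 e2. Qed.

Lemma run_nset a i e f g t q (Q : state K -> Prop) :
  Q (State (upd f a (neval f i) (neval f e)) g t q) ->
  run (NSet a i e) (State f g t q) Q.
Proof. by move=> h; eexists; [constructor | exact: h]. Qed.

Lemma run_fconst a i (b : bool) f g t q (Q : state K -> Prop) :
  Q (State f (upd g a (neval f i) b%:R) t q) ->
  run (FConst a i b) (State f g t q) Q.
Proof. by move=> h; eexists; [constructor | exact: h]. Qed.

Lemma run_fcopy a i a1 i1 f g t q (Q : state K -> Prop) :
  Q (State f (upd g a (neval f i) (g a1 (neval f i1))) t q) ->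
  run (FCopy a i a1 i1) (State f g t q) Q.
Proof. by move=> h; eexists; [constructor | exact: h]. Qed.

Lemma run_fop o z a i a1 i1 a2 i2 f g t q (Q : state K -> Prop) :
  fop_eval o (g a1 (neval f i1)) (g a2 (neval f i2)) = Some z ->
  Q (State f (upd g a (neval f i) z) t.+1 q) ->
  run (FOp o a i a1 i1 a2 i2) (State f g t q) Q.
Proof. by move=> h h'; eexists; [constructor; exact: h | exact: h']. Qed.

Lemma run_fsample a i f g t q (Q : state K -> Prop) :
  Q (State f (upd g a (neval f i) (tape q)) t.+1 q.+1) ->
  run (FSample a i) (State f g t q) Q.
Proof. by move=> h; eexists; [constructor | exact: h]. Qed.

Lemma run_fifzero a i c1 c2 f g t q Q :
  run (if g a (neval f i) == 0 then c1 else c2) (State f g t.+1 q) Q ->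
  run (FIfZero a i c1 c2) (State f g t q) Q.
Proof. by case=> s e h; exists s => //; constructor. Qed.

Lemma run_nif e c1 c2 s Q :
  run (if neval (nmem s) e != 0%N then c1 else c2) s Q -> run (NIf e c1 c2) s Q.
Proof. by case=> s' h h'; exists s' => //; constructor. Qed.

(** The invariant is indexed by the number of iterations still to come, so termination is part of
    it. *)
Lemma run_while e c N (Inv : nat -> state K -> Prop) s Q :
  Inv N s ->
  (forall k s', Inv k.+1 s' -> neval (nmem s') e <> 0%N /\ run c s' (Inv k)) ->
  (forall s', Inv 0%N s' -> neval (nmem s') e = 0%N /\ Q s') ->
  run (While e c) s Q.
Proof.
move=> h0 hS hQ; elim: N s h0 => [|N IH] s.
  by move=> /hQ[e0 q]; exists s => //; constructor.
move=> /hS[e0 [s1 x1 /IH[s2 x2 q]]]; exists s2 => //.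
exact: ExecWhileStep x1 x2.
Qed.

Definition setn s v x : state K :=
  State (upd (nmem s) v 0%N x) (fmem s) (nops s) (nsmp s).

Definition For v e c : cmd :=
  Seq (NSet v (NLit 0) (NLit 0))
    (While (NSub e (NGet v (NLit 0)))
       (Seq c (NSet v (NLit 0) (NAdd (NGet v (NLit 0)) (NLit 1))))).

(** Here the index counts completed iterations. The invariant must pin the counter and the loop
    bound, since the body could overwrite both. *)
Lemma run_for v e c N (Inv : nat -> state K -> Prop) s Q :
  Inv 0%N (setn s v 0) ->
  (forall i s', Inv i s' -> nmem s' v 0%N = i /\ neval (nmem s') e = N) ->
  (forall i s', (i < N)%N -> Inv i s' ->
     run c s' (fun s'' => Inv i.+1 (setn s'' v (nmem s'' v 0%N).+1))) ->
  (forall s', Inv N s' -> Q s') ->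
  run (For v e c) s Q.
Proof.
move=> h0 hv hS hQ; apply: run_seq; case: s h0 => f g t q h0; apply: run_nset.
apply: (@run_while _ _ N (fun k s' => (k <= N)%N /\ Inv (N - k)%N s')).
- by rewrite leqnn subnn.
- move=> k s' [kN /[dup] /hv[/= -> ->] inv]; split; first by lia.
  apply: run_seq; have lt : (N - k.+1 < N)%N by lia.
  have := hS _ _ lt inv; apply: run_weaken => -[f' g' t' q'] /= h; apply: run_nset.
  by split; [exact: ltnW | rewrite /= addn1; rewrite subnSK in h].
- by move=> s' [_]; rewrite subn0 => /[dup] /hv[/= -> ->] /hQ; rewrite subnn.
Qed.

Lemma updE T (f : nat -> nat -> T) a i x b j :
  upd f a i x b j = if (b == a) && (j == i) then x else f b j.
Proof. by []. Qed.

Lemma upd_upd T (f : nat -> nat -> T) a i x y : upd (upd f a i x) a i y = upd f a i y.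
Proof. by apply/funext => b; apply/funext => j; rewrite /upd; case: (_ && _). Qed.

Lemma upd_id T (f : nat -> nat -> T) a i : upd f a i (f a i) = f.
Proof.
by apply/funext => b; apply/funext => j; rewrite /upd; case: ifP => // /andP[/eqP-> /eqP->].
Qed.

Lemma updC T (f : nat -> nat -> T) a i x b j y : (a == b) = false ->
  upd (upd f a i x) b j y = upd (upd f b j y) a i x.
Proof.
move=> ab; apply/funext => c; apply/funext => k; rewrite /upd.
by case: (c =P b) => [->|] //=; rewrite [b == a]eq_sym ab.
Qed.

Definition eq_off10 g g' := forall (a k : nat), a != 10%N -> g' a k = g a k.

(* Loop counters live in arrays 8 and 9, array 10 of field elements is scratch. *)
Definition Dot e guard d i a1 i1 a2 i2 : cmd :=
  Seq (FConst d i false)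
    (For 9 e
       (NIf guard
          (Seq (FOp FMul 10 (NLit 0) a1 i1 a2 i2)
               (FOp FAdd d i d i 10 (NLit 0)))
          Skip)).

(** Only the iterations that pass the guard are charged, 2 operations each: guards act on naturals,
    which are free. Costs below therefore count guarded indices, not loop lengths. *)
Lemma run_dot e guard (d : nat) i (a1 : nat) i1 (a2 : nat) i2 f g t q V di Q :
  d != 10%N -> a1 != 10%N -> a2 != 10%N -> a1 != d -> a2 != d ->
  neval f i = di ->
  (forall y, neval (upd f 9 0 y) i = di) ->
  (forall y, neval (upd f 9 0 y) e = V) ->
  let P v := neval (upd f 9 0 v) guard != 0%N in
  let F v := g a1 (neval (upd f 9 0 v) i1) * g a2 (neval (upd f 9 0 v) i2) in
  (forall g', eq_off10 (upd g d di (\sum_(v < V) if P v then F v else 0)) g' ->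
     Q (State (upd f 9 0 V) g' (t + 2 * \sum_(v < V) (P v : nat))%N q)) ->
  run (Dot e guard d i a1 i1 a2 i2) (State f g t q) Q.
Proof.
move=> d10 a110 a210 a1d a2d idi hi he P F HQ; apply: run_seq; apply: run_fconst.
apply: (@run_for _ _ _ V (fun k s' => exists g',
  eq_off10 (upd g d di (\sum_(v < k) if P v then F v else 0)) g' /\
  s' = State (upd f 9 0 k) g' (t + 2 * \sum_(v < k) (P v : nat))%N q)).
- exists (upd g d di 0); rewrite idi; split; last by rewrite !big_ord0 addn0.
  by move=> a k _; rewrite big_ord0.
- by move=> k s' [g' [_ ->]] /=; rewrite he.
- move=> k s' kV [g' [h ->]]; apply: run_nif => /=; rewrite -/(P k).
  case: ifP => Pk.
    apply: run_seq; apply: run_fop => //=; apply: run_fop => //=.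
    eexists; split; last first.
      rewrite /setn /= upd_upd big_ord_recr /= Pk addn_mul2S; reflexivity.
    move=> a l a10; rewrite !hi !updE eqxx /= (negPf d10) /= (negPf a10) /=.
    rewrite !h ?updE //; case: ifP => [_|-> //].
    by rewrite big_ord_recr /= Pk !eqxx /= (negPf a1d) (negPf a2d).
  apply: run_skip; exists g'; split; last by rewrite /setn /= upd_upd big_ord_recr /= Pk addn0.
  by move=> a l a10; rewrite h // big_ord_recr /= Pk addr0.
- by move=> s' [g' [h ->]]; apply: HQ.
Qed.

Definition setuv f u v := upd (upd f 8 0 u) 9 0 v.

Lemma setuv_setuv f a b c d : setuv (setuv f a b) c d = setuv f c d.
Proof. by rewrite /setuv (updC _ _ _ _ _ (erefl : (9 == 8)%N = false)) !upd_upd. Qed.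

Definition Dots eU eV guard d a1 i1 a2 i2 : cmd :=
  For 8 eU (Dot eV guard d (NGet 8 (NLit 0)) a1 i1 a2 i2).

(** The value [y] left in the inner counter is quantified because it is [V] only if the outer loop
    runs at least once. *)
Lemma run_dots eU eV guard (d a1 : nat) i1 (a2 : nat) i2 f g t q U V Q :
  d != 10%N -> a1 != 10%N -> a2 != 10%N -> a1 != d -> a2 != d ->
  (forall x y, neval (setuv f x y) eU = U) ->
  (forall x y, neval (setuv f x y) eV = V) ->
  let P u v := neval (setuv f u v) guard != 0%N in
  let F u v := g a1 (neval (setuv f u v) i1) * g a2 (neval (setuv f u v) i2) in
  (forall g' y,
     (forall (a k : nat), a != 10%N -> g' a k = if (a == d) && (k < U)%N then
        \sum_(v < V) (if P k v then F k v else 0) else g a k) ->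
     Q (State (setuv f U y) g' (t + 2 * \sum_(u < U) \sum_(v < V) (P u v : nat))%N q)) ->
  run (Dots eU eV guard d a1 i1 a2 i2) (State f g t q) Q.
Proof.
move=> d10 a110 a210 a1d a2d hU hV P F HQ.
apply: (@run_for _ _ _ U (fun u s' => exists g' y,
  (forall (a k : nat), a != 10%N -> g' a k = if (a == d) && (k < u)%N then
        \sum_(v < V) (if P k v then F k v else 0) else g a k) /\
  s' = State (setuv f u y) g' (t + 2 * \sum_(u < u) \sum_(v < V) (P u v : nat))%N q)).
- exists g, (f 9%N 0%N); split; first by move=> *; rewrite ltn0 andbF.
  rewrite /setn /= big_ord0 addn0 /setuv; congr State.
  by rewrite -[LHS](upd_id _ 9 0).
- by move=> u s' [g' [y [_ ->]]]; rewrite hU.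
- move=> u s' uU [g' [y [h ->]]].
  have suv z : upd (setuv f u y) 9 0 z = setuv f u z by rewrite /setuv upd_upd.
  apply: (@run_dot _ _ _ _ _ _ _ _ _ _ _ _ V u) => //.
    by move=> z; rewrite suv hV.
  move=> g'' h''; exists g'', V; split; last first.
    rewrite big_ord_recr /= mulnDr addnA /setn /= !suv.
    congr State; last by congr (_ + 2 * _)%N; apply: eq_bigr => v _; rewrite suv.
    by rewrite /setuv (updC _ _ _ _ _ (erefl : (9 == 8)%N = false)) upd_upd.
  move=> a k a10; rewrite h'' // updE; case: (a =P d) => [->|ad] /=; last first.
    by rewrite h // (introF eqP ad).
  case: (k =P u) => [->|ku].
    rewrite ltnS leqnn; apply: eq_bigr => v _; rewrite suv !h //.
    by rewrite (negPf a1d) (negPf a2d).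
  by rewrite h // eqxx /= ltnS [(k <= u)%N]leq_eqVlt (introF eqP ku).
- by move=> s' [g' [y [h ->]]]; apply: HQ.
Qed.

Definition MulSub e guard d a1 i1 a2 i2 : cmd :=
  For 9 e
    (NIf guard
       (Seq (FOp FMul 10 (NLit 0) a1 i1 a2 i2)
            (FOp FSub d (NGet 9 (NLit 0)) d (NGet 9 (NLit 0)) 10 (NLit 0)))
       Skip).

Lemma run_mulsub e guard (d a1 : nat) i1 (a2 : nat) i2 f g t q V Q :
  d != 10%N -> a1 != 10%N -> a2 != 10%N -> a1 != d -> a2 != d ->
  (forall y, neval (upd f 9 0 y) e = V) ->
  let P v := neval (upd f 9 0 v) guard != 0%N in
  let F v := g a1 (neval (upd f 9 0 v) i1) * g a2 (neval (upd f 9 0 v) i2) in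
  (forall g',
     (forall (a k : nat), a != 10%N ->
        g' a k = if [&& a == d, (k < V)%N & P k] then g a k - F k else g a k) ->
     Q (State (upd f 9 0 V) g' (t + 2 * \sum_(v < V) (P v : nat))%N q)) ->
  run (MulSub e guard d a1 i1 a2 i2) (State f g t q) Q.
Proof.
move=> d10 a110 a210 a1d a2d he P F HQ.
apply: (@run_for _ _ _ V (fun v s' => exists g',
  (forall (a k : nat), a != 10%N ->
        g' a k = if [&& a == d, (k < v)%N & P k] then g a k - F k else g a k) /\
  s' = State (upd f 9 0 v) g' (t + 2 * \sum_(v < v) (P v : nat))%N q)).
- by exists g; split; [move=> *; rewrite ltn0 andbF | rewrite big_ord0 addn0].
- by move=> k s' [g' [_ ->]] /=; rewrite he.
- move=> v s' vV [g' [h ->]]; apply: run_nif => /=; rewrite -/(P v).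
  case: ifP => Pv.
    apply: run_seq; apply: run_fop => //=; apply: run_fop => //=.
    eexists; split; last first.
      rewrite /setn /= upd_upd big_ord_recr /= Pv addn_mul2S; reflexivity.
    move=> a l a10; rewrite !updE eqxx /= (negPf d10) /= (negPf a10) /=.
    rewrite !h // eqxx ltnn /= (negPf a1d) (negPf a2d) /=.
    case: (a =P d) => [->|] //=.
    case: (l =P v) => [->|lv]; first by rewrite ltnS leqnn Pv.
    by rewrite ltnS [(l <= v)%N]leq_eqVlt (introF eqP lv).
  apply: run_skip; exists g'; split; last by rewrite /setn /= upd_upd big_ord_recr /= Pv addn0.
  move=> a l a10; rewrite h //; case: (l =P v) => [->|lv]; first by rewrite Pv !andbF.
  by rewrite ltnS [(l <= v)%N]leq_eqVlt (introF eqP lv).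
- by move=> s' [g' [h ->]]; apply: HQ.
Qed.

End Execution.

(** * Gaussian elimination *)

Section Elimination.
Variable K : fieldType.

(** The Schur complement of a pivot, kept at full size: its row and column become zero instead of
    being removed, so indices never shift. *)
Definition elim m n (W : 'M[K]_(m, n)) i j : 'M[K]_(m, n) :=
  W - (W i j)^-1 *: (col j W *m row i W).

Lemma elimE m n (W : 'M[K]_(m, n)) i j a b :
  elim W i j a b = W a b - (W i j)^-1 * (W a j * W i b).
Proof. by rewrite !mxE big_ord1 !mxE. Qed.

Lemma elim_row0 m n (W : 'M[K]_(m, n)) i j : W i j != 0 ->
  row i (elim W i j) = 0.
Proof. by move=> h; apply/rowP => b; rewrite mxE elimE mxE mulKf // subrr. Qed.

Lemma elim_col0 m n (W : 'M[K]_(m, n)) i j : W i j != 0 ->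
  col j (elim W i j) = 0.
Proof.
by move=> h; apply/colP => a; rewrite mxE elimE mxE mulrCA mulVf // mulr1 subrr.
Qed.

(** The row space of [W] is the direct sum of those of [elim W i j] and [row i W]: column [j] of the
    former is zero, so a multiple of [row i W] lying there is zero. *)
Lemma rank_elim m n (W : 'M[K]_(m, n)) i j : W i j != 0 ->
  \rank W = (\rank (elim W i j)).+1.
Proof.
move=> h; set V := elim W i j.
have nz : row i W != 0.
  by apply: contraNneq h => /rowP/(_ j); rewrite !mxE => ->.
have cap0 : (V :&: row i W)%MS = 0.
  apply/eqP/rowV0P => u; rewrite sub_capmx => /andP[/submxP[D uD] /sub_rVP[a ua]].
  have : u 0 j = 0.
    rewrite uD; transitivity ((D *m col j V) 0 0); last by rewrite elim_col0 // mulmx0 mxE.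
    by rewrite !mxE; apply: eq_bigr => k _; rewrite !mxE.
  rewrite ua !mxE => /eqP; rewrite mulf_eq0 (negPf h) orbF => /eqP ->.
  by rewrite scale0r.
have eqW : (V + row i W :=: W)%MS.
  apply/eqmxP/andP; split.
    rewrite addsmx_sub row_sub andbT /V /elim.
    rewrite addmx_sub // eqmx_opp scalemx_sub //.
    by rewrite (submx_trans (submxMl _ _)) // row_sub.
  have {1}-> : W = V + (W i j)^-1 *: (col j W *m row i W) by rewrite /V /elim subrK.
  by rewrite addmx_sub_adds // scalemx_sub // submxMl.
by rewrite -eqW mxrank_disjoint_sum // rank_rV nz addn1.
Qed.

Definition in_leading m n (i j : nat) (p : 'I_m * 'I_n) := (p.1 < i)%N && (p.2 < j)%N.

(** Elimination commutes with taking a leading submatrix that contains the pivot. *)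
Lemma leading_elim m n (W : 'M[K]_(m, n)) i j (hi : (i <= m)%N) (hj : (j <= n)%N)
    (a : 'I_m) (b : 'I_n) : W a b != 0 -> in_leading i j (a, b) ->
  \rank (leading hi hj W) = (\rank (leading hi hj (elim W a b))).+1.
Proof.
move=> h /andP[/= ha hb].
have ea : widen_ord hi (Ordinal ha) = a by apply: val_inj.
have eb : widen_ord hj (Ordinal hb) = b by apply: val_inj.
rewrite (@rank_elim _ _ _ (Ordinal ha) (Ordinal hb)) ?mxE ?ea ?eb //.
by congr (\rank _).+1; apply/matrixP => x y; rewrite [RHS]mxE !elimE !mxE ea eb.
Qed.

Lemma leading_full m n (W : 'M[K]_(m, n)) : leading (leqnn m) (leqnn n) W = W.
Proof. by apply/matrixP => a b; rewrite mxE; congr (W _ _); apply: val_inj. Qed.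

Lemma leading0 m n i j (hi : (i <= m)%N) (hj : (j <= n)%N) :
  leading hi hj (0 : 'M[K]_(m, n)) = 0.
Proof. by apply/matrixP => a b; rewrite !mxE. Qed.

Definition pivot_mx m n (p : seq ('I_m * 'I_n)) : 'M[K]_(m, n) :=
  \matrix_(i, j) ((i, j) \in p)%:R.

(** Each one is alone in its row and column, so eliminating it merely deletes it; induction on [p]
    then counts the ones. *)
Lemma rank_leading_pivot_mx m n (p : seq ('I_m * 'I_n)) i j
    (hi : (i <= m)%N) (hj : (j <= n)%N) :
  uniq (map fst p) -> uniq (map snd p) ->
  \rank (leading hi hj (pivot_mx p)) = count (in_leading i j) p.
Proof.
elim: p => [|[a b] p IH] /=.
  have -> : pivot_mx [::] = 0 :> 'M[K]_(m, n) by apply/matrixP => x y; rewrite !mxE.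
  by rewrite leading0 mxrank0.
move=> /andP[na ua] /andP[nb ub].
have Eab y : pivot_mx ((a, b) :: p) a y = (y == b)%:R.
  rewrite mxE inE xpair_eqE eqxx /=; case: eqP => //= _.
  case: (boolP (_ \in p)) => // hp; case/negP: na.
  by apply/mapP; exists (a, y).
have Eba x : pivot_mx ((a, b) :: p) x b = (x == a)%:R.
  rewrite mxE inE xpair_eqE eqxx andbT; case: eqP => //= _.
  case: (boolP (_ \in p)) => // hp; case/negP: nb.
  by apply/mapP; exists (x, b).
have elimEp : elim (pivot_mx ((a, b) :: p)) a b = pivot_mx p.
  apply/matrixP => x y; rewrite elimE Eab Eba Eab eqxx invr1 mul1r !mxE inE xpair_eqE.
  case: (boolP ((x, y) \in p)) => hp.
    have xa : x != a by apply: contra na => /eqP <-; apply/mapP; exists (x, y).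
    by rewrite (negPf xa) mul0r subr0.
  by rewrite orbF -natrM mulnb subrr.
case: (boolP (in_leading i j (a, b))) => hl.
  by rewrite (leading_elim _ _ _ hl) ?elimEp ?IH // Eab eqxx oner_neq0.
rewrite -(IH ua ub); congr (\rank _); apply/matrixP => x y; rewrite !mxE inE.
case: eqP => //= -[ea eb]; case/negP: hl.
by rewrite /in_leading /= -ea -eb /= !ltn_ord.
Qed.

Definition lead_at n (v : 'rV[K]_n) (j : 'I_n) :=
  (v 0 j != 0) && [forall k : 'I_n, (k < j)%N ==> (v 0 k == 0)].

Lemma lead_at_uniq n (v : 'rV[K]_n) j j' : lead_at v j -> lead_at v j' -> j = j'.
Proof.
move=> /andP[h1 /forallP h2] /andP[h3 /forallP h4].
apply: val_inj; case: (ltngtP j j') => // lt.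
  by have := h4 j; rewrite lt /= (negPf h1).
by have := h2 j'; rewrite lt /= (negPf h3).
Qed.

Lemma lead_at_ex n (v : 'rV[K]_n) : v != 0 -> exists j, lead_at v j.
Proof.
move=> nz; have [j hj] : exists j, v 0 j != 0.
  apply/existsP; apply: contraR nz => /existsPn h.
  by apply/eqP/rowP => j; rewrite mxE; apply/eqP/negPn/h.
case: (@arg_minnP _ j (fun j => v 0 j != 0) val hj) => k hk mink.
exists k; rewrite /lead_at hk; apply/forallP => l; apply/implyP => lk.
by apply: contraLR lk => /mink /=; rewrite -leqNgt.
Qed.

(** The reference process against which the program is checked. Pivots are appended in the order in
    which the program outputs them. *)
Fixpoint gauss m n (A : 'M[K]_(m, n)) (k : nat) : 'M[K]_(m, n) * seq ('I_m * 'I_n) :=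
  if k is k'.+1 then
    let Wp := gauss A k' in
    if insub k' is Some i then
      if [pick j | lead_at (row i Wp.1) j] is Some j
      then (elim Wp.1 i j, rcons Wp.2 (i, j)) else Wp
    else Wp
  else (A, [::]).

Lemma gauss_skip m n (A : 'M[K]_(m, n)) (i : 'I_m) :
  row i (gauss A i).1 = 0 -> gauss A i.+1 = gauss A i.
Proof.
move=> h /=; rewrite valK h; case: pickP => // j.
by rewrite /lead_at mxE eqxx.
Qed.

Lemma gauss_step m n (A : 'M[K]_(m, n)) (i : 'I_m) j :
  lead_at (row i (gauss A i).1) j ->
  gauss A i.+1 = (elim (gauss A i).1 i j, rcons (gauss A i).2 (i, j)).
Proof.
move=> h /=; rewrite valK; case: pickP => [j' h'|/(_ j)]; last by rewrite h.
by rewrite (lead_at_uniq h h').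
Qed.

Variant gauss_spec m n (A : 'M[K]_(m, n)) (i : 'I_m) :
    'M[K]_(m, n) * seq ('I_m * 'I_n) -> Prop :=
| GaussSkip of row i (gauss A i).1 = 0 : gauss_spec A i (gauss A i)
| GaussStep j of lead_at (row i (gauss A i).1) j :
    gauss_spec A i (elim (gauss A i).1 i j, rcons (gauss A i).2 (i, j)).

Lemma gaussP m n (A : 'M[K]_(m, n)) (i : 'I_m) : gauss_spec A i (gauss A i.+1).
Proof.
have [h|/lead_at_ex[j h]] := eqVneq (row i (gauss A i).1) 0.
  by rewrite gauss_skip //; constructor.
by rewrite (gauss_step h); constructor.
Qed.

Lemma gauss_mono m n (A : 'M[K]_(m, n)) k k' : (k <= k')%N ->
  {subset (gauss A k).2 <= (gauss A k').2}.
Proof.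
move=> /subnK <-; elim: (k' - k)%N => // d IH ij /IH {IH}; rewrite addSn /=.
case: insub => // i; case: pickP => // j _ h.
by rewrite mem_rcons inE h orbT.
Qed.

(** The last clause carries the theorem: a pivot lowers by one the rank of the leading submatrices
    of [W] that contain it and leaves the others unchanged. Once [W] is zero, the leading ranks of
    [A] count pivots. *)
Lemma gauss_inv m n (A : 'M[K]_(m, n)) k : (k <= m)%N ->
  let: (W, p) := gauss A k in
  [/\ forall i : 'I_m, (i < k)%N -> row i W = 0,
      forall i j, (i, j) \in p -> (i < k)%N /\ col j W = 0,
      uniq (map fst p), uniq (map snd p) &
      forall i j (hi : (i <= m)%N) (hj : (j <= n)%N),
        \rank (leading hi hj A) = (\rank (leading hi hj W) + count (in_leading i j) p)%N].
Proof.
elim: k => [|k IH] km /=; first by split=> // *; rewrite addn0.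
have {IH} := IH (ltnW km); rewrite -/(gauss A k.+1).
pose i0 := Ordinal km; rewrite -[k.+1]/(i0.+1) -[k]/(val i0).
case: gaussP; case E: (gauss A i0) => [W p] /=.
  move=> h [H1 H2 H3 H4 H5]; split=> // [i|i j /H2[]].
    by rewrite ltnS leq_eqVlt => /predU1P[e|/H1 //]; rewrite -h; congr row; apply: val_inj.
  by move=> /ltnW.
move=> j /andP[nz /forallP lz] [H1 H2 H3 H4 H5]; rewrite mxE in nz.
have Wlt (a : 'I_m) b : (a < k)%N -> W a b = 0.
  by move=> /H1 /rowP /(_ b); rewrite !mxE.
split.
- move=> i; rewrite ltnS leq_eqVlt => /predU1P[e|lik].
    by have -> : i = i0 by [apply: val_inj]; rewrite elim_row0.
  by apply/rowP => b; rewrite mxE elimE (Wlt i b) // (Wlt i j) // mul0r mulr0 subr0 mxE.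
- move=> a b; rewrite mem_rcons inE => /predU1P[[-> ->]|hp]; first by rewrite elim_col0.
  have [h1 h2] := H2 _ _ hp; split; first exact: ltnW.
  apply/colP => c; move/colP: h2 => h2.
  by have := h2 c; have := h2 i0; rewrite !mxE big_ord1 !mxE => -> ->; rewrite !mulr0 subr0.
- rewrite map_rcons rcons_uniq H3 andbT.
  by apply/mapP => -[[a b] /H2[h _] /= e]; move: h; rewrite -e ltnn.
- rewrite map_rcons rcons_uniq H4 andbT.
  apply/mapP => -[[a b] /H2[_ h] /= e]; move: nz; rewrite e.
  by move/colP: h => /(_ i0); rewrite !mxE => ->; rewrite eqxx.
move=> a b ha hb; rewrite H5 -cats1 count_cat /= addn0.
case: (boolP (in_leading a b (i0, j))) => hl.
  by rewrite (leading_elim _ _ nz hl) addSnnS addn1 addnS.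
rewrite addn0; congr (\rank _ + _)%N; apply/matrixP => x y; rewrite !mxE big_ord1 !mxE.
(* When the leading submatrix misses the pivot, either [b <= j], and row [i0] is zero before column
   [j], or [a <= k], and the rows above [i0] are already zero. *)
suff -> : W (widen_ord ha x) j * W i0 (widen_ord hb y) = 0 by rewrite mulr0 subr0.
case: (ltnP k a) => [ka|ak].
  have lt : (y < j)%N.
    move: hl; rewrite /in_leading /= ka /= -leqNgt.
    by apply: leq_trans; apply: ltn_ord.
  by have := lz (widen_ord hb y); rewrite lt /= mxE => /eqP ->; rewrite mulr0.
by rewrite Wlt ?mul0r //=; apply: leq_trans ak.
Qed.

Lemma rank_leading_gauss m n (A : 'M[K]_(m, n)) i j (hi : (i <= m)%N) (hj : (j <= n)%N) :
  \rank (leading hi hj A) = count (in_leading i j) (gauss A m).2.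
Proof.
have := @gauss_inv _ _ A m (leqnn m); case: gauss => W p [H1 _ _ _ ->] /=.
have -> : W = 0 by apply/row_matrixP => a; rewrite H1 // row0.
by rewrite leading0 mxrank0.
Qed.

Lemma size_gauss m n (A : 'M[K]_(m, n)) : size (gauss A m).2 = \rank A.
Proof.
rewrite -{2}(leading_full A) rank_leading_gauss -size_filter; congr size.
by symmetry; apply/all_filterP/allP => -[a b] _; rewrite /in_leading !ltn_ord.
Qed.

Lemma gauss_rank_profile m n (A : 'M[K]_(m, n)) :
  is_rank_profile_matrix A (pivot_mx (gauss A m).2).
Proof.
have := @gauss_inv _ _ A m (leqnn m); have := size_gauss A.
have := rank_leading_gauss A; case: gauss => W p /= rk sz [_ _ H3 H4 _].
have rkE i j (hi : (i <= m)%N) (hj : (j <= n)%N) :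
    \rank (leading hi hj (pivot_mx p)) = \rank (leading hi hj A).
  by rewrite rank_leading_pivot_mx // rk.
split=> //.
- by rewrite -[pivot_mx p]leading_full rkE leading_full.
- have -> : supp (pivot_mx p) = [set ij in p].
    by apply/setP => -[a b]; rewrite !inE /= mxE; case: (_ \in p); rewrite ?oner_eq0 ?eqxx.
  by rewrite cardsE -sz; apply/card_uniqP/(map_uniq H3).
- by move=> i j; rewrite mxE; case: (_ \in p); rewrite // eqxx.
Qed.

End Elimination.

(** * Random dyadic sums *)

Section RandomTape.
Variable K : fieldType.

Lemma tape_of_tnth (S : seq K) n (w : n.-tuple 'I_(size S)) (k : 'I_n) :
  tape_of w k = nth 0 S (tnth w k).
Proof.
rewrite /tape_of (nth_map (tnth w k)) ?size_tuple //.
by rewrite [tnth w k in RHS](tnth_nth (tnth w k)).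
Qed.

(** Once the other coordinates are fixed, the equation determines coordinate [j], as [c j] is
    nonzero and [S] has no repetition. Hence replacing that coordinate of a root by any index is an
    injective operation. *)
Lemma card_root_tape (S : seq K) n (c : 'I_n -> K) j : uniq S -> c j != 0 ->
  (#|[set w : n.-tuple 'I_(size S) | (\sum_k c k * tape_of w k == 0)%R]| * size S
     <= #|{: n.-tuple 'I_(size S)}|)%N.
Proof.
move=> uS cj; set B := [set w | _].
pose f (wa : n.-tuple 'I_(size S) * 'I_(size S)) :=
  [tuple if k == j then wa.2 else tnth wa.1 k | k < n].
rewrite -[X in (_ * X)%N]card_ord -cardsT -cardsX -(@card_in_imset _ _ f) ?max_card //.
move=> [w a] [w' a'] /setXP[hw _] /setXP[hw' _] e.
have ek k : tnth (f (w, a)) k = tnth (f (w', a')) k by rewrite e.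
have ea : a = a' by have := ek j; rewrite !tnth_mktuple eqxx.
have ewk k : k != j -> tnth w k = tnth w' k.
  by move=> /negPf kj; have := ek k; rewrite !tnth_mktuple kj.
suff ej : tnth w j = tnth w' j.
  congr pair => //; apply: eq_from_tnth => k.
  by have [->|/ewk] := eqVneq k j.
move: hw hw'; rewrite !inE => /eqP + /eqP.
rewrite (bigD1 j) //= [X in _ -> X = 0 -> _](bigD1 j) //=.
under eq_bigr => k kj do rewrite tape_of_tnth ewk // -tape_of_tnth.
move=> h1 h2; move: (etrans h1 (esym h2)) => /addIr /(mulfI cj) /eqP.
by rewrite !tape_of_tnth nth_uniq // => /eqP /val_inj ->.
Qed.

(** The union bound, stated without quotients. *)
Lemma card_has_le (T : finType) (es : seq {set T}) q tot :
  (forall E, E \in es -> (#|E| * q <= tot)%N) ->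
  (#|[set w | has (fun E : {set T} => w \in E) es]| * q <= size es * tot)%N.
Proof.
elim: es => [|E es IH] h /=.
  by rewrite (eq_card0 (_ : [set w | false] =i pred0)) // => w; rewrite !inE.
have -> : [set w | (w \in E) || has (fun E : {set T} => w \in E) es] =
    E :|: [set w | has (fun E : {set T} => w \in E) es] by apply/setP => w; rewrite !inE.
apply: (leq_trans (leq_mul (leq_card_setU _ _) (leqnn q))); rewrite mulnDl mulSn leq_add //.
  by apply: h; rewrite inE eqxx.
by apply: IH => F hF; apply: h; rewrite inE hF orbT.
Qed.

(** Node [b] at level [l] of the dyadic tree covers the columns from [b * 2 ^ l] up to, but
    excluding, [(b + 1) * 2 ^ l]; the leaves are at level 0. *)
Definition node_sum n (v : 'rV[K]_n) (x : nat -> K) (l b : nat) : K :=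
  \sum_(k < n | (k %/ 2 ^ l == b)%N) v 0 k * x k.

(* Each node of the dyadic tree above a pivot column has a nonzero sum, so that
   a binary search for the leftmost nonzero entry cannot leave the right path. *)
Definition separating m n (A : 'M[K]_(m, n)) (x : nat -> K) (L : nat) : bool :=
  all (fun ij : 'I_m * 'I_n =>
    all (fun l => node_sum (row ij.1 (gauss A ij.1).1) x l (ij.2 %/ 2 ^ l) != 0)
      (iota 0 L.+1)) (gauss A m).2.

Lemma gauss_pivot_neq0 m n (A : 'M[K]_(m, n)) k i j :
  (i, j) \in (gauss A k).2 -> (gauss A i).1 i j != 0.
Proof.
elim: k => [//|k IH] /=; case: insubP => [i0 _ ei0|_ /IH //].
case: pickP => [j0 h|_ /IH //]; rewrite mem_rcons inE => /predU1P[[-> ->]|/IH //].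
by move: h => /andP[]; rewrite mxE ei0.
Qed.

(** Union bound over [\rank A * L.+1] bad events, one per pivot and level. The pivot column lies
    under its own node with a nonzero coefficient, so each event takes at most a fraction
    [1 / size S] of the tapes. *)
Lemma card_separating (S : seq K) m n (A : 'M[K]_(m, n)) L : uniq S ->
  (2 * (\rank A * L.+1) <= size S)%N ->
  (#|{: n.-tuple 'I_(size S)}| <=
     2 * #|[set w : n.-tuple 'I_(size S) | separating A (tape_of w) L]|)%N.
Proof.
move=> uS hS; set G := [set w | _]; set p := (gauss A m).2.
pose B (ij : 'I_m * 'I_n) l := [set w : n.-tuple 'I_(size S) |
   (node_sum (row ij.1 (gauss A ij.1).1) (tape_of w) l (ij.2 %/ 2 ^ l) == 0)%R].
pose es := [seq B ij l | ij <- p, l <- iota 0 L.+1].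
have GE : ~: G = [set w | has (fun E : {set n.-tuple 'I_(size S)} => w \in E) es].
  apply/setP => w; rewrite !inE; apply: negb_inj; rewrite negbK; apply/idP/idP.
    move=> /allP h; apply/hasPn => E /allpairsP[[ij l] [/= hij hl ->]] /=.
    by rewrite inE; have /allP := h _ hij; apply.
  move=> /hasPn h; apply/allP => ij hij; apply/allP => l hl.
  have : B ij l \in es by apply/allpairsP; exists (ij, l).
  by move=> /h /=; rewrite inE.
have : (#|~: G| * size S <= size es * #|{: n.-tuple 'I_(size S)}|)%N.
  rewrite GE; apply: card_has_le => E /allpairsP[[[i j] l] [/= hij hl ->]].
  rewrite /B /node_sum /=.
  pose c (k : 'I_n) := if (k %/ 2 ^ l == j %/ 2 ^ l)%N then (gauss A i).1 i k else 0.
  have cj : c j != 0 by rewrite /c eqxx (gauss_pivot_neq0 hij).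
  apply: leq_trans (card_root_tape uS cj); rewrite leq_mul2r; apply/orP; right.
  apply: subset_leq_card; apply/fintype.subsetP => w; rewrite !inE big_mkcond /=.
  move=> /eqP h; apply/eqP; rewrite -[RHS]h; apply: eq_bigr => k _; rewrite /c mxE.
  by case: eqP => // _; rewrite mul0r.
rewrite /es size_allpairs size_iota size_gauss -(cardsC G).
(* With [S] empty one cannot cancel [size S]; but then the rank is 0, and without pivots every tape
   is separating. *)
have [S0|] := posnP (size S).
  have : (\rank A * L.+1 = 0)%N by lia.
  move=> /eqP; rewrite muln_eq0 orbF => /eqP r0.
  have -> : ~: G = finset.set0.
    have p0 : (gauss A m).2 = [::] by apply: size0nil; rewrite size_gauss.
    by apply/setP => w; rewrite !inE /separating p0.
  by rewrite cards0; lia.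
move: #|G| #|~: G| => x y.
move: (\rank A * L.+1)%N (size S) hS => z s hs s0 h.
suff : (y <= x)%N by lia.
rewrite -(leq_pmul2r s0) -(leq_pmul2l (erefl : 0 < 2)%N).
have : (2 * z * (x + y) <= s * (x + y))%N by rewrite leq_mul2r hs orbT.
lia.
Qed.

End RandomTape.

(** * The program *)

(* Arrays of naturals, besides the input and the output: 3, the support of A in
   row-major order; 4, the powers of 2; 5, the depth L of the dyadic tree; 6 and 7,
   the flags of the pivot rows and of the pivot columns; 8 and 9, loop counters;
   10, the current row; 11 and 12, the position in the search.
   Arrays of field elements: 1, A in row-major order; 2, x; 3, the dyadic sums;
   4, M; 5, M A x; 6 and 7, the factors of the rank one update of M; 8, the second
   factor divided by the pivot; 10, scratch; 11 to 15, scalars. *)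
Local Notation vm := (NGet 0 (NLit 0)).
Local Notation vn := (NGet 0 (NLit 1)).
Local Notation vs := (NGet 0 (NLit 2)).
Local Notation vL := (NGet 5 (NLit 0)).
Local Notation vu := (NGet 8 (NLit 0)).
Local Notation vv := (NGet 9 (NLit 0)).
Local Notation vi := (NGet 10 (NLit 0)).
Local Notation vb := (NGet 11 (NLit 0)).
Local Notation vl := (NGet 12 (NLit 0)).
Local Notation flagA e := (NGet 3 e).
Local Notation flagI e := (NGet 6 e).
Local Notation flagJ e := (NGet 7 e).
Local Notation "c1 ;; c2" := (Seq c1 c2) (at level 70, right associativity).

(** * Flat indices and counts of flagged entries *)

Lemma sub_divnM v d : (v - v %/ d * d = v %% d)%N.
Proof. by rewrite {1}(divn_eq v d) addKn. Qed.

Lemma divn_flat i n j : (j < n)%N -> ((i * n + j) %/ n = i)%N.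
Proof. by move=> jn; rewrite divnMDl ?divn_small ?addn0 //; case: n jn. Qed.

Lemma modn_flat i n j : (j < n)%N -> ((i * n + j) %% n = j)%N.
Proof. by move=> jn; rewrite modnMDl modn_small. Qed.

Lemma ltn_flat i m j n : (i < m)%N -> (j < n)%N -> (i * n + j < m * n)%N.
Proof.
move=> im jn; apply: (@leq_trans (i.+1 * n)); last by rewrite leq_mul2r im orbT.
by rewrite mulSnr ltn_add2l.
Qed.

Lemma sum_flat m n (F : nat -> nat -> nat) :
  (\sum_(v < m * n) F (v %/ n) (v %% n) = \sum_(i < m) \sum_(j < n) F i j)%N.
Proof.
elim: m => [|m IH]; first by rewrite !big_ord0.
rewrite big_ord_recr /= -IH mulSnr big_split_ord /=; congr addn.
by apply: eq_bigr => j _; rewrite divn_flat ?modn_flat.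
Qed.

Definition cnt (f : nat -> nat) n : nat := (\sum_(k < n) (f k != 0))%N.

Lemma sum_cntM (f1 f2 : nat -> nat) m n :
  (\sum_(u < m) \sum_(v < n) ((f1 u * f2 v)%N != 0%N : nat) = cnt f1 m * cnt f2 n)%N.
Proof.
rewrite /cnt big_distrlr /=; apply: eq_bigr => u _; apply: eq_bigr => v _.
by rewrite muln_eq0 negb_or mulnb.
Qed.

Lemma cnt_set (f f' : nat -> nat) n i :
  (forall k, f' k = if k == i then 1%N else f k) -> (cnt f' n <= (cnt f n).+1)%N.
Proof.
move=> h; rewrite /cnt; case: (ltnP i n) => [lt|ge].
  pose i0 := Ordinal lt; rewrite (bigD1 i0) //= h eqxx /= add1n ltnS.
  rewrite [leqRHS](bigD1 i0) //=; apply: leq_trans (leq_addl _ _).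
  apply: leq_sum => k ki; rewrite h; case: (nat_of_ord k =P i) => // e.
  by case/eqP: ki; apply: val_inj.
apply: leqW; apply: leq_sum => k _; rewrite h; case: (nat_of_ord k =P i) => // e.
by move: (ltn_ord k); rewrite e ltnNge ge.
Qed.

(** * Properties of dyadic sums, and the vector representing a reduced row *)

Section Reduction.
Variables (K : fieldType) (tape : nat -> K).
Local Notation run := (run tape).
Implicit Types (f : nat -> nat -> nat) (g : nat -> nat -> K).

Definition rep_mx m n (h : nat -> K) (B : 'M[K]_(m, n)) :=
  forall (i : 'I_m) (j : 'I_n), h (i * n + j)%N = B i j.

Lemma node_sumS n (v : 'rV[K]_n) x l b :
  node_sum v x l.+1 b = node_sum v x l (2 * b) + node_sum v x l (2 * b + 1).
Proof.
rewrite /node_sum (bigID (fun k : 'I_n => (k %/ 2 ^ l == 2 * b)%N)) /=.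
congr (_ + _); apply: eq_bigl => k; rewrite expnSr divnMA;
  move: (k %/ 2 ^ l)%N => c; lia.
Qed.

(** The stored sums of the rows of [A] give those of any combination of these rows, which itself is
    never formed. *)
Lemma node_sum_mul m n (h : 'rV[K]_m) (A : 'M[K]_(m, n)) x l b :
  node_sum (h *m A) x l b = \sum_a h 0 a * node_sum (row a A) x l b.
Proof.
rewrite /node_sum; under eq_bigr => k _ do rewrite mxE mulr_suml.
rewrite exchange_big /=; apply: eq_bigr => a _; rewrite mulr_sumr.
by apply: eq_bigr => k _; rewrite mxE mulrA.
Qed.

Lemma node_sumN n (v : 'rV[K]_n) x l b : node_sum (- v) x l b = - node_sum v x l b.
Proof. by rewrite /node_sum -sumrN; apply: eq_bigr => k _; rewrite mxE mulNr. Qed.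

Lemma node_sum_leaf n (v : 'rV[K]_n) x b :
  node_sum v x 0 b != 0 -> exists2 j : 'I_n, b = j & v 0 j != 0.
Proof.
move=> nz; have [j /andP[/eqP e vj]] : exists j : 'I_n, (j %/ 2 ^ 0 == b)%N && (v 0 j != 0).
  apply/existsP; apply: contraR nz => /existsPn h; rewrite /node_sum big1 // => k kb.
  by have := h k; rewrite kb /= negbK => /eqP ->; rewrite mul0r.
by exists j; rewrite // -e expn0 divn1.
Qed.

(** Keeps the block index of the search within the table of dyadic sums. *)
Lemma node_sum_neq0 n (v : 'rV[K]_n) x l b :
  node_sum v x l b != 0 -> (b * 2 ^ l < n)%N.
Proof.
move=> nz; rewrite ltnNge; apply: contra nz => h; rewrite /node_sum big1 // => k /eqP e.
have := leq_trunc_div k (2 ^ l); rewrite e => /(leq_trans h).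
by rewrite leqNgt ltn_ord.
Qed.

Lemma node_sum_lt_lead n (v : 'rV[K]_n) x l b j : lead_at v j ->
  (b < j %/ 2 ^ l)%N -> node_sum v x l b = 0.
Proof.
move=> /andP[_ /forallP h] lt; rewrite /node_sum big1 // => k /eqP e.
have kj : (k < j)%N by rewrite ltnNge; apply/negP => /(leq_div2r (2 ^ l)); lia.
by have := h k; rewrite kj => /eqP ->; rewrite mul0r.
Qed.

Definition Reduce : cmd :=
  Dots vm vn (NMul (flagI vu) (flagJ vv)) 6 1 (NAdd (NMul vi vn) vv) 4 (NAdd (NMul vv vm) vu) ;;
  FOp FSub 6 vi 6 vi 13 (NLit 0) ;;
  NSet 6 vi (NLit 1).

(** The vector left in array 6 represents the reduced row: its product with [A] is the opposite of
    row [i] of [A - A *m M *m A]. The flags skip only zero products, as [M] is supported on them. *)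
Lemma run_reduce m n (A : 'M[K]_(m, n)) (M : 'M[K]_(n, m)) (i : 'I_m) f g t q Q :
  f 0%N 0%N = m -> f 0%N 1%N = n -> f 10%N 0%N = i -> rep_mx (g 1%N) A -> rep_mx (g 4%N) M ->
  g 13%N 0%N = 1 -> (forall k l, M k l != 0 -> f 7%N k != 0%N /\ f 6%N l != 0%N) ->
  (forall f' g',
    (forall a k : nat, a != 8 -> a != 9 ->
       f' a k = if (a == 6) && (k == i) then 1 else f a k)%N ->
    (forall a k : nat, a != 10%N -> a != 6%N -> g' a k = g a k) ->
    (forall l : 'I_m, g' 6%N l = (row i A *m M - delta_mx 0 i) 0 l) ->
    Q (State f' g' (t + 2 * (cnt (f 6%N) m * cnt (f 7%N) n) + 1)%N q)) ->
  run Reduce (State f g t q) Q.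
Proof.
move=> fm fn fi gA gM g1 supM HQ; apply: run_seq.
apply: (@run_dots _ _ _ _ _ _ _ _ _ _ f g t q m n) => //.
move=> g' y hg'; apply: run_seq; apply: run_fop => //=; apply: run_nset => /=.
rewrite (_ : (_ + _).+1 = (t + 2 * (cnt (f 6%N) m * cnt (f 7%N) n) + 1)%N); last first.
  by rewrite addn1; congr (_ + 2 * _).+1; rewrite -sum_cntM.
apply: HQ => [a k a8 a9|a k a10 a6|l].
- by rewrite /setuv !updE fi (negPf a8) (negPf a9).
- by rewrite !updE (negPf a6) /= hg' // (negPf a6).
rewrite /setuv !updE /= fi.
have hz : g' 6%N l = (row i A *m M) 0 l.
  rewrite hg' //= ltn_ord mxE; apply: eq_bigr => v _.
  rewrite /setuv !updE /= fi fn fm gA gM mxE; case: ifP => //.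
  have [->|/supM[h1 h2]] := eqVneq (M v l) 0; first by rewrite mulr0.
  by rewrite muln_eq0 negb_or h1 h2.
rewrite [RHS]mxE -hz !mxE eqxx /=; case: eqP => [e|ne].
  by rewrite (val_inj e) eqxx [g' 13%N _]hg' //= g1.
by rewrite (introF eqP (fun e => ne (congr1 val e))) subr0.
Qed.

End Reduction.

(** * Binary search for the pivot column *)

Section Searching.
Variables (K : fieldType) (tape : nat -> K).
Local Notation run := (run tape).
Implicit Types (f : nat -> nat -> nat) (g : nat -> nat -> K).

Definition Search : cmd :=
  NSet 11 (NLit 0) (NLit 0) ;;
  NSet 12 (NLit 0) vL ;;
  While vl
    (NSet 12 (NLit 0) (NSub vl (NLit 1)) ;;
     NSet 11 (NLit 0) (NMul (NLit 2) vb) ;;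
     Dots (NLit 1) vm (flagI vv) 11 6 vv
       3 (NAdd (NMul (NAdd (NMul vv (NAdd vL (NLit 1))) vl) vn) vb) ;;
     FIfZero 11 (NLit 0) (NSet 11 (NLit 0) (NAdd vb (NLit 1))) Skip).

(** The sum of the current node stays nonzero down to the leaf, so the entry found is nonzero
    whatever [x] is. Only left sums are computed: when one vanishes, the right child inherits the
    sum of its parent. *)
Lemma run_search m n (A : 'M[K]_(m, n)) (h : 'rV[K]_m) x L f g t q Q :
  f 0%N 0%N = m -> f 0%N 1%N = n -> f 5%N 0%N = L ->
  (forall l : 'I_m, g 6%N l = h 0 l) ->
  (forall l, h 0 l != 0 -> f 6%N l != 0%N) ->
  (forall (a : 'I_m) l b, (l <= L)%N -> (b < n)%N ->
     g 3%N ((a * (L + 1) + l) * n + b)%N = node_sum (row a A) x l b) ->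
  node_sum (h *m A) x L 0 != 0 ->
  (forall f' g' (j : 'I_n),
    (forall a k : nat, a != 8 -> a != 9 -> a != 11 -> a != 12 -> f' a k = f a k)%N ->
    f' 11%N 0%N = j ->
    (forall a k : nat, a != 10%N -> a != 11%N -> g' a k = g a k) ->
    (h *m A) 0 j != 0 ->
    (forall j', lead_at (h *m A) j' ->
       (forall l, (l <= L)%N -> node_sum (h *m A) x l (j' %/ 2 ^ l) != 0) -> j = j') ->
    Q (State f' g' (t + L * (2 * cnt (f 6%N) m + 1))%N q)) ->
  run Search (State f g t q) Q.
Proof.
move=> fm fn fL gh suph gD nz HQ; set v := h *m A in nz HQ.
apply: run_seq; apply: run_nset; apply: run_seq; apply: run_nset.
apply: (@run_while _ _ _ _ L (fun lv s => exists f' g' b,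
  [/\ s = State f' g' (t + (L - lv) * (2 * cnt (f 6%N) m + 1))%N q,
      (forall a k : nat, a != 8 -> a != 9 -> a != 11 -> a != 12 -> f' a k = f a k)%N,
      f' 11%N 0%N = b /\ f' 12%N 0%N = lv,
      (forall a k : nat, a != 10%N -> a != 11%N -> g' a k = g a k) &
      [/\ (lv <= L)%N, node_sum v x lv b != 0 &
      forall j', lead_at v j' ->
       (forall l, (l <= L)%N -> node_sum v x l (j' %/ 2 ^ l) != 0) -> b = (j' %/ 2 ^ lv)%N]])).
- exists (upd (upd f 11 0 0) 12 0 L), g, 0%N; split=> //.
  + by rewrite subnn mul0n addn0 /= updE /= fL.
  + by move=> a k _ _ a11 a12; rewrite !updE (negPf a11) (negPf a12).
  (* At the root, the nonzero sum over block 0 places the leading column in that block; otherwise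
     the whole block would precede it and vanish. *)
  split=> // j' /andP[_ /forallP hj'] _; move: nz; rewrite /node_sum => nz.
  apply/esym/eqP; apply: contraR nz => j'0; rewrite big1 // => k.
  have jL : (j' %/ 2 ^ L > 0)%N by rewrite lt0n.
  move=> /eqP kL; have kj : (k < j')%N.
    by rewrite ltnNge; apply/negP => /(leq_div2r (2 ^ L)); rewrite kL leqNgt jL.
  by have := hj' k; rewrite kj => /eqP ->; rewrite mul0r.
- move=> lv s [f' [g' [b [-> Hf [fb fl] Hg [lvL nzb leadb]]]]]; split; first by rewrite /= fl.
  apply: run_seq; apply: run_nset; apply: run_seq; apply: run_nset.
  rewrite /= !updE /= fl fb subn1 /=; apply: run_seq.
  set f1 := upd _ 11 0 _.
  have b2n : (2 * b < n)%N.
    have := node_sum_neq0 nzb; apply: leq_ltn_trans; rewrite mulnC leq_mul2l expnS.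
    by rewrite leq_pmulr ?orbT // expn_gt0.
  apply: (@run_dots _ _ _ _ _ _ _ _ _ _ _ _ _ _ 1 m) => //.
    by move=> a c; rewrite /= /f1 /setuv !updE /= Hf.
  move=> g'' y hg''; apply: run_fifzero => /=.
  have -> : g'' 11%N 0%N = node_sum v x lv (2 * b).
    rewrite hg'' //= node_sum_mul; apply: eq_bigr => a _.
    rewrite /f1 /setuv !updE /= !Hf // fL fn !Hg // gh gD ?(ltnW lvL) //.
    by case: ifP => // /eqP fa; have [->|/suph] := eqVneq (h 0 a) 0; rewrite ?mul0r // fa.
  have cost : ((t + (L - lv.+1) * (2 * cnt (f 6%N) m + 1) +
      2 * \sum_(u < 1) \sum_(v < m) (neval (setuv f1 u v) (flagI vv) != 0)).+1 =
      t + (L - lv) * (2 * cnt (f 6%N) m + 1))%N.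
    rewrite big_ord1 /= (_ : \sum_(_ < m) _ = cnt (f 6%N) m)%N.
      by rewrite -(subnSK lvL); lia.
    by apply: eq_bigr => a _; rewrite /f1 /setuv !updE /= Hf.
  have half j' : b = (j' %/ 2 ^ lv.+1)%N ->
      (j' %/ 2 ^ lv = 2 * b \/ j' %/ 2 ^ lv = 2 * b + 1)%N.
    by rewrite expnSr divnMA; move: (j' %/ 2 ^ lv)%N => c; lia.
  have Hg2 (a k : nat) : a != 10%N -> a != 11%N -> g'' a k = g a k.
    by move=> a10 a11; rewrite hg'' // (negPf a11) Hg.
  case: eqP => [z|/eqP nz2].
    apply: run_nset; rewrite cost; do 3!eexists; split; first reflexivity.
    + move=> a k a8 a9 a11 a12; rewrite /setuv /f1 !updE.
      by rewrite (negPf a8) (negPf a9) (negPf a11) (negPf a12) /= Hf.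
    + by split; rewrite /= /setuv /f1 !updE /=.
    + exact: Hg2.
    split; first exact: ltnW.
      by move: nzb; rewrite node_sumS z add0r.
    (* Were the leading column in the left child, the left sum would be nonzero by [sj']. *)
    move=> j' lj' sj'; have := half _ (leadb _ lj' sj'); case=> // e.
    by have := sj' _ (ltnW lvL); rewrite e z eqxx.
  apply: run_skip; rewrite cost; do 3!eexists; split; first reflexivity.
  + move=> a k a8 a9 a11 a12; rewrite /setuv /f1 !updE.
    by rewrite (negPf a8) (negPf a9) (negPf a11) (negPf a12) /= Hf.
  + by split; rewrite /= /setuv /f1 !updE /=.
  + exact: Hg2.
  split; [exact: ltnW | by [] |].
  (* Were the leading column in the right child, the left block would be zero, against its nonzero
     sum. *)
  move=> j' lj' sj'; have := half _ (leadb _ lj' sj'); case=> // e.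
  by move: nz2; rewrite (node_sum_lt_lead _ lj') ?eqxx // e addn1.
move=> s [f' [g' [b [-> Hf [fb fl] Hg [_ nzb leadb]]]]]; split=> //=.
rewrite subn0; have [j bj vj] := node_sum_leaf nzb.
apply: (HQ _ _ j) => //; first by rewrite fb.
by move=> j' lj' sj'; apply: val_inj; rewrite /= -bj (leadb j') // expn0 divn1.
Qed.

End Searching.

(** * Rank one update of the padded inverse *)

Section Updating.
Variables (K : fieldType) (tape : nat -> K).
Local Notation run := (run tape).
Implicit Types (f : nat -> nat -> nat) (g : nat -> nat -> K).

Definition Update : cmd :=
  Dots (NLit 1) vm (flagI vv) 14 6 vv 1 (NAdd (NMul vv vn) vb) ;;
  Dots vn vm (NMul (flagJ vu) (flagI vv)) 7 4 (NAdd (NMul vu vm) vv) 1 (NAdd (NMul vv vn) vb) ;;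
  FOp FSub 7 vb 7 vb 13 (NLit 0) ;;
  NSet 7 vb (NLit 1) ;;
  FOp FDiv 15 (NLit 0) 13 (NLit 0) 14 (NLit 0) ;;
  Dots vn (NLit 1) (flagJ vu) 8 7 vu 15 (NLit 0) ;;
  MulSub (NMul vn vm)
    (NMul (flagJ (NDiv vv vm)) (flagI (NSub vv (NMul (NDiv vv vm) vm))))
    4 8 (NDiv vv vm) 6 (NSub vv (NMul (NDiv vv vm) vm)) ;;
  MulSub vn (flagJ vv) 5 8 vv 12 (NLit 0).

(** The terms of the cost come from [tau], from [M *m col j A], from one subtraction and one
    division, from scaling [c] and updating array 5, and from correcting [M]. The last two have
    [cJ.+1] because column [j] is flagged before them. *)
Lemma run_update m n (A : 'M[K]_(m, n)) (M : 'M[K]_(n, m)) (h : 'rV[K]_m)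
    (zp : 'I_n -> K) (j : 'I_n) f g t q Q :
  let tau := (h *m A) 0 j in
  let c := M *m col j A - delta_mx j 0 in
  f 0%N 0%N = m -> f 0%N 1%N = n -> f 11%N 0%N = j ->
  rep_mx (g 1%N) A -> rep_mx (g 4%N) M -> (forall k : 'I_n, g 5%N k = zp k) ->
  (forall l : 'I_m, g 6%N l = h 0 l) -> g 13%N 0%N = 1 ->
  (forall k l, M k l != 0 -> f 7%N k != 0%N /\ f 6%N l != 0%N) ->
  (forall l, h 0 l != 0 -> f 6%N l != 0%N) ->
  tau != 0 ->
  (forall f' g' t',
    (forall a k : nat, a != 8 -> a != 9 ->
       f' a k = if (a == 7) && (k == j) then 1 else f a k)%N ->
    (forall a k : nat, a \notin [:: 4; 5; 7; 8; 10; 14; 15]%N -> g' a k = g a k) ->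
    rep_mx (g' 4%N) (M - tau^-1 *: (c *m h)) ->
    (forall k : 'I_n, g' 5%N k = zp k - tau^-1 * c k 0 * g 12%N 0%N) ->
    (forall k, c k 0 != 0 -> f' 7%N k != 0%N) ->
    let cI := cnt (f 6%N) m in let cJ := cnt (f 7%N) n in
    (t' <= t + 2 * cI + 2 * (cJ * cI) + 2 + 4 * cJ.+1 + 2 * (cJ.+1 * cI))%N ->
    Q (State f' g' t' q)) ->
  run Update (State f g t q) Q.
Proof.
move=> tau c fm fn fb gA gM gz gh g1 supM suph tau0 HQ.
have m0 : (0 < m)%N.
  rewrite lt0n; apply: contra tau0 => /eqP m0; rewrite /tau mxE big1 // => -[a la] _.
  by exfalso; move: la; rewrite m0.
apply: run_seq; apply: (@run_dots _ _ _ _ _ _ _ _ _ _ _ _ _ _ 1 m) => //.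
move=> ga ya ha.
have tauE : ga 14%N 0%N = tau.
  rewrite ha //= /tau mxE; apply: eq_bigr => a _; rewrite /setuv !updE /= fn fb gh gA.
  by case: ifP => // /eqP fa; have [->|/suph] := eqVneq (h 0 a) 0; rewrite ?mul0r // fa.
have fra (a k : nat) : a != 10%N -> a != 14%N -> ga a k = g a k.
  by move=> a10 a14; rewrite ha // (negPf a14).
apply: run_seq; apply: (@run_dots _ _ _ _ _ _ _ _ _ _ _ _ _ _ n m) => //.
move=> gb yb hb; rewrite !setuv_setuv.
have yE (k : 'I_n) : gb 7%N k = (M *m col j A) k 0.
  rewrite hb //= ltn_ord mxE; apply: eq_bigr => a _.
  rewrite /setuv !updE /= fn fm fb !fra // gM gA mxE; case: ifP => //.
  have [->|/supM[h1 h2]] := eqVneq (M k a) 0; first by rewrite mul0r.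
  by rewrite muln_eq0 negb_or h1 h2.
have frb (a k : nat) : a != 10%N -> a != 14%N -> a != 7%N -> gb a k = g a k.
  by move=> a10 a14 a7; rewrite hb // (negPf a7) fra.
have tauEb : gb 14%N 0%N = tau by rewrite hb.
apply: run_seq; apply: run_fop => //=; apply: run_seq; apply: run_nset => /=.
apply: run_seq; apply: run_fop => /=.
  by rewrite !updE /= tauEb (negPf tau0); reflexivity.

set gc := upd _ 15 _ _; set fc := upd _ 7 _ _.
have fcE (a k : nat) : a != 8%N -> a != 9%N ->
    fc a k = if (a == 7%N) && (k == j) then 1%N else f a k.
  by move=> a8 a9; rewrite /fc /setuv !updE /= fb (negPf a8) (negPf a9).
have gc7 (k : 'I_n) : gc 7%N k = c k 0.
  rewrite /gc /setuv !updE /= fb /c [RHS]mxE -yE !mxE andbT.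
  case: eqP => [e|ne]; first by rewrite (val_inj e) eqxx [gb 13%N _]frb // g1.
  by rewrite (introF eqP (fun e => ne (congr1 val e))) subr0.
have gc15 : gc 15%N 0%N = tau^-1.
  by rewrite /gc /setuv !updE /= frb // g1 div1r.
have frc (a k : nat) : a \notin [:: 7; 10; 14; 15]%N -> gc a k = g a k.
  rewrite !inE !negb_or => /and4P[a7 a10 a14 a15].
  by rewrite /gc /setuv !updE (negPf a7) (negPf a15) /= frb.
have supc (k : 'I_n) : c k 0 != 0 -> fc 7%N k != 0%N.
  rewrite fcE //=; case: ifP => // /negbT kj.
  rewrite /c !mxE andbT -(inj_eq val_inj) (negPf kj) subr0 => nz.
  have [a Ma] : exists a, M k a != 0.
    apply/existsP; apply: contraR nz => /existsPn Mk; rewrite big1 // => a _.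
    by have := Mk a; rewrite negbK => /eqP ->; rewrite mul0r.
  by have [] := supM _ _ Ma.
clearbody c.
apply: run_seq; apply: (@run_dots _ _ _ _ _ _ _ _ _ _ _ _ _ _ n 1) => //.
move=> gd yd hd.
have gd8 (k : 'I_n) : gd 8%N k = tau^-1 * c k 0.
  rewrite hd //= ltn_ord big_ord1 /setuv !updE /= gc7 gc15 mulrC.
  case: ifP => // /eqP fk; have [->|/supc] := eqVneq (c k 0) 0; first by rewrite mulr0.
  by rewrite fk.
have frd (a k : nat) : a \notin [:: 7; 8; 10; 14; 15]%N -> gd a k = g a k.
  rewrite !inE !negb_or => /and5P[a7 a8 a10 a14 a15].
  by rewrite hd // (negPf a8) frc // !inE !negb_or a7 a10 a14.
set fd := setuv fc n yd.
have fdE (a k : nat) : a != 8%N -> a != 9%N -> fd a k = fc a k.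
  by move=> a8 a9; rewrite /fd /setuv !updE (negPf a8) (negPf a9).
apply: run_seq; apply: (@run_mulsub _ _ _ _ _ _ _ _ _ _ _ _ _ (n * m)%N) => //.
  by move=> b; rewrite /= !updE /= !fdE // !fcE //= fm fn.
move=> ge he.
have ge4 : rep_mx (ge 4%N) (M - tau^-1 *: (c *m h)).
  move=> k l; rewrite he //= !updE /= !fdE // [fc 0%N _]fcE //= fm divn_flat // addKn.
  rewrite ltn_flat //= [gd 4%N _]frd // [gd 6%N _]frd // gM gd8 gh !mxE big_ord1.
  rewrite [fc 6%N _]fcE //= mulrA.
  case: ifP => // /negbFE/eqP z; suff -> : tau^-1 * c k 0 * h 0 l = 0 by rewrite subr0.
  have [->|/supc ck] := eqVneq (c k 0) 0; first by rewrite mulr0 mul0r.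
  have [->|/suph hl] := eqVneq (h 0 l) 0; first by rewrite mulr0.
  by move/eqP: z; rewrite muln_eq0 (negPf ck) (negPf hl).
apply: (@run_mulsub _ _ _ _ _ _ _ _ _ _ _ _ _ n) => //.
move=> gf hf; apply: HQ.
- by move=> a k a8 a9; rewrite !updE (negPf a9) /= fdE // fcE.
- move=> a k; rewrite !inE !negb_or => /and5P[a4 a5 a7 a8 /and3P[a10 a14 a15]].
  rewrite hf // (negPf a5) he // (negPf a4) frd // !inE !negb_or.
  by rewrite a7 a8 a10 a14.
- by move=> k l; rewrite hf //= ge4.
- move=> k; rewrite hf //= ltn_ord !updE /= fdE // !he //=.
  rewrite [gd 5%N _]frd // [gd 12%N _]frd // gz gd8.
  case: ifP => // /negbFE/eqP fk; have [->|/supc] := eqVneq (c k 0) 0.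
    by rewrite mulr0 mul0r subr0.
  by rewrite fk.
- by move=> k /supc; rewrite !updE /= fdE.
set cI := cnt (f 6%N) m; set cJ := cnt (f 7%N) n.
have fd6 k : fd 6%N k = f 6%N k by rewrite fdE // fcE.
have fd7 k : fd 7%N k = fc 7%N k by rewrite fdE.
have cJle : (cnt (fc 7%N) n <= cJ.+1)%N by apply: (@cnt_set _ _ _ j) => k; rewrite fcE.
have e1 : (\sum_(u < 1) \sum_(v < m) (setuv f u v 6 (setuv f u v 9 0) != 0) = cI)%N.
  by rewrite big_ord1; apply: eq_bigr.
have e2 : (\sum_(u < n) \sum_(v < m)
    (setuv (setuv f 1 ya) u v 7 (setuv (setuv f 1 ya) u v 8 0) *
     setuv (setuv f 1 ya) u v 6 (setuv (setuv f 1 ya) u v 9 0) != 0) = cJ * cI)%N.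
  by rewrite -sum_cntM.
have e3 : (\sum_(u < n) \sum_(v < 1) (neval (setuv fc u v) (flagJ vu) != 0) = cnt (fc 7%N) n)%N.
  by apply: eq_bigr => u _; rewrite big_ord1.
have e4 : (\sum_(v < n * m) (neval (upd fd 9 0 v)
      (NMul (flagJ (NDiv vv vm)) (flagI (NSub vv (NMul (NDiv vv vm) vm)))) != 0) =
    cnt (fc 7%N) n * cI)%N.
  rewrite -(sum_cntM (fc 7%N) (f 6%N)) -(sum_flat n m (fun u v => (fc 7%N u * f 6%N v != 0)%N)).
  apply: eq_bigr => v _; rewrite /= !updE /= fd7 fd6 fdE // [fc 0%N _]fcE //= fm.
  by rewrite sub_divnM.
have e5 : (\sum_(v < n)
    (neval (upd (upd fd 9 0 (n * m)) 9 0 v) (flagJ vv) != 0) = cnt (fc 7%N) n)%N.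
  by apply: eq_bigr => u _; rewrite /= !updE /= fd7.
rewrite e1 e2 e3 e4 e5; have : (cnt (fc 7%N) n * cI <= cJ.+1 * cI)%N by rewrite leq_mul2r cJle orbT.
lia.
Qed.

End Updating.

(** * Processing one row, with its invariant and cost *)

Section Elimination_run.
Variables (K : fieldType) (tape : nat -> K).
Local Notation run := (run tape).
Implicit Types (f : nat -> nat -> nat) (g : nat -> nat -> K).

Section Schur.
Variables (m n : nat) (A : 'M[K]_(m, n)) (M : 'M[K]_(n, m)) (i : 'I_m) (j : 'I_n).
Let W := A - A *m M *m A.
Let h := row i A *m M - delta_mx 0 i.
Let c := M *m col j A - delta_mx j 0.

Lemma schur_row : h *m A = - row i W.
Proof. by rewrite mulmxBl -rowE -!row_mul -raddfB -raddfN opprB. Qed.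

Lemma schur_col : A *m c = - col j W.
Proof. by rewrite /c !colE mulmxBr !mulmxA -[RHS]mulNmx opprB mulmxBl. Qed.

(** As [h *m A = - row i W] and [A *m c = - col j W], correcting [M] by a multiple of [c *m h]
    performs an elimination step on [W], which is never stored. *)
Lemma schur_update : W i j != 0 ->
  A - A *m (M - ((h *m A) 0 j)^-1 *: (c *m h)) *m A = elim W i j.
Proof.
move=> nz; rewrite mulmxBr mulmxBl opprB addrA addrAC -/W /elim; congr (_ + _).
rewrite -scalemxAr -scalemxAl !mulmxA schur_col -!mulmxA schur_row.
by rewrite mulNmx mulmxN opprK !mxE invrN scaleNr.
Qed.

End Schur.

Lemma lead_atN n (v : 'rV[K]_n) j : lead_at (- v) j = lead_at v j.
Proof.
rewrite /lead_at !mxE oppr_eq0; congr (_ && _); apply: eq_forallb => k.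
by rewrite mxE oppr_eq0.
Qed.

Lemma node_sumD n (u v : 'rV[K]_n) x l b :
  node_sum (u + v) x l b = node_sum u x l b + node_sum v x l b.
Proof. by rewrite /node_sum -big_split; apply: eq_bigr => k _; rewrite mxE mulrDl. Qed.

Lemma node_sumZ n (u : 'rV[K]_n) a x l b : node_sum (a *: u) x l b = a * node_sum u x l b.
Proof. by rewrite /node_sum mulr_sumr; apply: eq_bigr => k _; rewrite mxE mulrA. Qed.

(** Array 5 holds [M A x] and the root sum of row [i] is [(A x)_i], so the scalar tested is
    [- (W x)_i] for [W = A - A *m M *m A]. It costs 2 operations per nonzero entry of the row, and 2
    more. *)
Definition Row : cmd :=
  Dots (NLit 1) vn (flagA (NAdd (NMul vi vn) vv)) 11 1 (NAdd (NMul vi vn) vv) 5 vv ;;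
  FOp FSub 12 (NLit 0) 11 (NLit 0) 3 (NMul (NAdd (NMul vi (NAdd vL (NLit 1))) vL) vn) ;;
  FIfZero 12 (NLit 0) Skip
    (Reduce ;; Search ;; Update ;;
     NSet 1 vs vi ;; NSet 2 vs vb ;; NSet 0 (NLit 2) (NAdd vs (NLit 1))).

Section Rows.
Variables (m n : nat) (A : 'M[K]_(m, n)) (x : nat -> K) (L t0 q : nat).

Definition row_nnz (a : nat) : nat :=
  (\sum_(k < n) (if insub a is Some i then (A i k != 0)%R else false))%N.

(** The leading costs [6 s ^ 2] for [s < r] sum to at most [2 r ^ 3]; the second term absorbs what
    is linear in [s], including the [L] tests of each search. *)
Definition pivot_cost r := (2 * r ^ 3 + 9 * L.+1 * r ^ 2)%N.

Definition pivots_of f r : seq (nat * nat) := [seq (f 1%N k, f 2%N k) | k <- iota 0 r].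

Definition val_pairs (p : seq ('I_m * 'I_n)) : seq (nat * nat) :=
  [seq (val ij.1, val ij.2) | ij <- p].

Definition loaded f g : Prop :=
  [/\ f 0%N 0%N = m, f 0%N 1%N = n, f 5%N 0%N = L &
      forall (i : 'I_m) (j : 'I_n), f 3%N (i * n + j)%N = (A i j != 0)] /\
  [/\ rep_mx (g 1%N) A,
      forall (a : 'I_m) l b, (l <= L)%N -> (b < n)%N ->
        g 3%N ((a * (L + 1) + l) * n + b)%N = node_sum (row a A) x l b &
      g 13%N 0%N = 1].

Definition partial_inverse (M : 'M[K]_(n, m)) r f g : Prop :=
  [/\ rep_mx (g 4%N) M,
      forall k : 'I_n, g 5%N k = node_sum (row k (M *m A)) x L 0,
      forall k l, M k l != 0 -> f 7%N k != 0%N /\ f 6%N l != 0%N,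
      (cnt (f 6%N) m <= r)%N & (cnt (f 7%N) n <= r)%N].

(** The rank equation and the cost hold on every tape, so there are never more than [\rank A] pivots
    and the running time is certain. Agreement with [gauss] is claimed for separating tapes only. *)
Definition row_inv (i : nat) (s : state K) : Prop := exists f g t r M,
  let W := A - A *m M *m A in
  [/\ s = State f g t q, loaded f g, f 10%N 0%N = i /\ f 0%N 2%N = r &
      partial_inverse M r f g] /\
  [/\ (\rank W + r = \rank A)%N,
      separating A x L -> W = (gauss A i).1 /\ pivots_of f r = val_pairs (gauss A i).2 &
      (t <= t0 + 2 * (i + \sum_(a < i) row_nnz a) + pivot_cost r)%N].

Lemma pivots_ofS f f' r i j :
  (forall a k : nat, a = 1%N \/ a = 2%N -> (k < r)%N -> f' a k = f a k) ->
  f' 1%N r = i -> f' 2%N r = j ->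
  pivots_of f' r.+1 = rcons (pivots_of f r) (i, j).
Proof.
move=> h <- <-; rewrite /pivots_of -[r.+1]addn1 iotaD map_cat cats1; congr rcons.
apply/eq_in_map => k; rewrite mem_iota => /andP[_ kr].
by rewrite !h //; [right | left].
Qed.

(* With [a] pivot rows and [b] pivot columns, the left-hand side adds the costs of
   Reduce, Search and Update. *)
Lemma pivot_costS r a b : (a <= r)%N -> (b <= r)%N ->
  (pivot_cost r + 2 * (a * b) + 1 + L * (2 * a.+1 + 1) + 2 * a.+1 +
     2 * (b * a.+1) + 2 + 4 * b.+1 + 2 * (b.+1 * a.+1) <= pivot_cost r.+1)%N.
Proof.
move=> ar br; rewrite /pivot_cost.
have h1 : (a * b <= r * r)%N by apply: leq_mul.
have h2 : (L * a <= L * r)%N by rewrite leq_mul2l ar orbT.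
rewrite !expnS !expn0; nia.
Qed.

Lemma node_sum_pivot (i : 'I_m) j l : separating A x L -> (l <= L)%N ->
  lead_at (row i (gauss A i).1) j ->
  node_sum (row i (gauss A i).1) x l (j %/ 2 ^ l) != 0.
Proof.
move=> sep lL lj; have inp : (i, j) \in (gauss A m).2.
  by apply: (gauss_mono (ltn_ord i)); rewrite (gauss_step lj) mem_rcons inE eqxx.
by have := allP (allP sep _ inp) l; rewrite mem_iota ltnS lL => /(_ isT).
Qed.

Lemma run_row i s : (0 < n)%N -> (n <= 2 ^ L)%N -> (i < m)%N -> row_inv i s ->
  run Row s (fun s' => row_inv i.+1 (setn s' 10 (nmem s' 10%N 0%N).+1)).
Proof.
move=> n0 nL im [f [g [t [r [M [[-> [[fm fn fL fA] [gA gD g1]] [fi fs] [gM gz supM cI cJ]]]]]]]].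
set W := A - _ => -[rk good cost].
pose i0 := Ordinal im; set h := row i0 A *m M - delta_mx 0 i0.
have hW : h *m A = - row i0 W by apply: schur_row.
have nnzi : row_nnz i = (\sum_(k < n) (A i0 k != 0)%R)%N.
  by apply: eq_bigr => k _; rewrite -[i]/(val i0) valK.
apply: run_seq; apply: (@run_dots _ _ _ _ _ _ _ _ _ _ _ _ _ _ 1 n) => //.
move=> g2 y hg2; apply: run_seq; apply: run_fop => //=.
set f2 := setuv f 1 y; have f2E (a k : nat) : a != 8%N -> a != 9%N -> f2 a k = f a k.
  by move=> a8 a9; rewrite /f2 /setuv !updE (negPf a8) (negPf a9).
rewrite !f2E // fi fL fn.
have -> : (\sum_(u < 1) \sum_(v < n)
   (setuv f u v 3 (setuv f u v 10 0 * setuv f u v 0 1 + setuv f u v 9 0) != 0) = row_nnz i)%N.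
  rewrite big_ord1 nnzi; apply: eq_bigr => v _; rewrite /setuv !updE /= fi fn.
  by rewrite (fA i0) eqb0 negbK.
(* The scalar tested is the root sum of [h *m A], obtained from the stored [M A x] and the stored
   root sum of row [i]. *)
have rhoE : g2 11%N 0%N - g2 3%N ((i * (L + 1) + L) * n)%N = node_sum (h *m A) x L 0.
  rewrite !hg2 //= -[X in g 3%N X]addn0 (gD i0) // mulmxBl -rowE.
  rewrite node_sumD node_sumN -mulmxA node_sum_mul; congr (_ - _).
  apply: eq_bigr => v _; rewrite /setuv !updE /= fi fn (gA i0) (fA i0) gz [row _ _ _ _]mxE.
  by have [->|] := eqVneq (A i0 v) 0; rewrite //= mul0r.
rewrite rhoE; have frg2 (a k : nat) : a != 10%N -> a != 11%N -> g2 a k = g a k.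
  by move=> a10 a11; rewrite hg2 // (negPf a11).
apply: run_fifzero; rewrite updE /=.
set t2 := (_ + _).+2; set g3 := upd _ 12 _ _.
have frg3 (a k : nat) : a != 10%N -> a != 11%N -> a != 12%N -> g3 a k = g a k.
  by move=> a10 a11 a12; rewrite /g3 !updE (negPf a12) /= frg2.
have t2E : (t2 <= t0 + 2 * (i.+1 + \sum_(a < i.+1) row_nnz a) + pivot_cost r)%N.
  rewrite /t2 big_ord_recr /=; move: cost.
  by move: (pivot_cost r) (row_nnz i) (\sum_(a < i) row_nnz a)%N => pc ni ns cost; lia.
case: eqP => [rho0|/eqP rho_neq0].
  apply: run_skip; exists (upd f2 10 0 i.+1), g3, t2, r, M; split; split=> //.
  - by rewrite /setn /= f2E // fi.
  - split; first by split=> // *; rewrite updE /= f2E.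
    by split=> [? ?|? ? ? ? ?|]; rewrite frg3 //; apply: gD.
  - by split=> // [a b|k]; rewrite frg3.
  move=> sep; have [Wg pg] := good sep.
  rewrite -/W (gauss_skip (i := i0)).
    split=> //; rewrite -pg; apply/eq_in_map => k _; rewrite !updE /= !f2E //.
  (* A nonzero row would have its leading column under node 0 of level [L], since [n <= 2 ^ L], and
     separation would make that sum nonzero. *)
  apply/eqP/negPn/negP => /lead_at_ex[j lj].
  have := node_sum_pivot sep (leqnn L) lj.
  rewrite divn_small ?(leq_trans (ltn_ord j)) // -Wg.
  by move: rho0; rewrite hW node_sumN => /eqP; rewrite oppr_eq0 => ->.
have row_neq0 : row i0 W != 0.
  apply: contra rho_neq0 => /eqP e; rewrite hW e oppr0 /node_sum big1 // => k _.
  by rewrite mxE mul0r.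
apply: run_seq; apply: (@run_reduce _ _ m n A M i0); rewrite ?f2E //.
- by move=> a b; rewrite frg3.
- by move=> a b; rewrite frg3.
- by rewrite frg3.
move=> f4 g4 f4E g4E h4.
have suph (l : 'I_m) : h 0 l != 0 -> f4 6%N l != 0%N.
  rewrite f4E //=; case: ifP => // /negbT li; rewrite f2E //.
  rewrite /h !mxE eqxx /= -(inj_eq val_inj) (negPf li) subr0 => nz.
  have [k Mk] : exists k, M k l != 0.
    apply/existsP; apply: contraR nz => /existsPn Mk; rewrite big1 // => k _.
    by have := Mk k; rewrite negbK => /eqP ->; rewrite mulr0.
  by have [] := supM _ _ Mk.
have {}h4 (l : 'I_m) : g4 6%N l = h 0 l by apply: h4.
have schurE j := @schur_update _ _ A M i0 j; rewrite -/h -/W in schurE.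
clearbody h.
apply: run_seq; apply: (@run_search _ _ m n A h x L); rewrite ?f4E ?f2E //.
  by move=> a l b lL bn; rewrite g4E // frg3 // gD.
move=> f5 g5 j f5E fj g5E vj leadj.
have Wij : W i0 j != 0 by move: vj; rewrite hW !mxE oppr_eq0.
apply: run_seq.
apply: (@run_update _ _ m n A M h (fun k => node_sum (row k (M *m A)) x L 0) j) => //.
- by rewrite f5E // f4E // f2E.
- by rewrite f5E // f4E // f2E.
- by move=> a b; rewrite g5E // g4E // frg3.
- by move=> a b; rewrite g5E // g4E // frg3.
- by move=> k; rewrite g5E // g4E // frg3.
- by move=> l; rewrite g5E.
- by rewrite g5E // g4E // frg3.
- move=> k l /supM[h1 h2]; rewrite !f5E // !f4E //= !f2E //; split=> //.
  by case: ifP.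
- by move=> l /suph; rewrite f5E.
move=> f6 g6 t6 f6E g6E M6 z6 supc cI5 cJ5 t6E.
apply: run_seq; apply: run_nset; apply: run_seq; apply: run_nset; apply: run_nset.
have f6f (a k : nat) : a \notin [:: 6; 7; 8; 9; 11; 12]%N -> f6 a k = f a k.
  rewrite !inE !negb_or => /and5P[a6 a7 a8 a9 /andP[a11 a12]].
  by rewrite f6E // (negPf a7) f5E // f4E // (negPf a6) f2E.
have f6s : f6 0%N 2%N = r by rewrite f6f.
have f6i : f6 10%N 0%N = i by rewrite f6f.
have f6b : f6 11%N 0%N = j by rewrite f6E // fj.
rewrite /setn /= !updE /= f6s f6i f6b addn1.
pose M' := M - ((h *m A) 0 j)^-1 *: ((M *m col j A - delta_mx j 0) *m h).
have W'E : A - A *m M' *m A = elim W i0 j by exact: schurE.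
set f7 := upd _ 10 _ _.
have f7E (a k : nat) : a \notin [:: 0; 1; 2; 10]%N -> f7 a k = f6 a k.
  rewrite !inE !negb_or => /and4P[a0 a1 a2 a10].
  by rewrite /f7 !updE (negPf a0) (negPf a1) (negPf a2) (negPf a10).
have f7f (a k : nat) : a \notin [:: 0; 1; 2; 6; 7; 8; 9; 10; 11; 12]%N -> f7 a k = f a k.
  rewrite !inE !negb_or => /and5P[a0 a1 a2 a6 /and5P[a7 a8 a9 a10 /andP[a11 a12]]].
  rewrite f7E ?f6f // !inE !negb_or ?a0 ?a1 ?a2 ?a10 //.
  by rewrite a6 a7 a8 a9 a11.
have g6g (a k : nat) : a \notin [:: 4; 5; 6; 7; 8; 10; 11; 12; 14; 15]%N -> g6 a k = g a k.
  rewrite !inE !negb_or => /and5P[a4 a5 a6 a7 /and5P[a8 a10 a11 a12 /andP[a14 a15]]].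
  rewrite g6E ?g5E ?g4E ?frg3 // !inE !negb_or.
  by rewrite a4 a5 a7 a8 a10 a14.
have cI4 : (cnt (f4 6%N) m <= r.+1)%N.
  apply: (@leq_trans (cnt (f 6%N) m).+1) => //; apply: (@cnt_set _ _ _ i) => k.
  by rewrite f4E //= f2E.
have cI' : (cnt (f7 6%N) m <= r.+1)%N.
  by rewrite (_ : cnt _ _ = cnt (f4 6%N) m) //; apply: eq_bigr => k _; rewrite f7E // f6E // f5E.
have cJ' : (cnt (f7 7%N) n <= r.+1)%N.
  apply: (@leq_trans (cnt (f 7%N) n).+1) => //; apply: (@cnt_set _ _ _ j) => k.
  by rewrite f7E // f6E //= f5E // f4E //= f2E.
exists f7, g6, t6, r.+1, M'; split; split=> //.
- split.
    split=> [|||a b]; [| | by rewrite f7f | by rewrite f7f].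
      by rewrite /f7 !updE /= f6f.
    by rewrite /f7 !updE /= f6f.
  by split=> [? ?|? ? ? ? ?|]; rewrite g6g //; apply: gD.
- split=> //.
  (* [M' A x] differs from [M A x] by a multiple of [c] whose factor involves [(h *m A) x], still in
     array 12 since the zero test. *)
  + move=> k; rewrite z6 /M' g5E // g4E // /g3 updE /=.
    rewrite mulmxBl raddfB /= -scalemxAl [row k (_ *: _)]linearZ /=.
    rewrite -mulmxA [row k (_ *m (h *m A))]row_mul.
    rewrite [row k (_ - _)]mx11_scalar mul_scalar_mx scalerA -scaleNr node_sumD node_sumZ.
    by rewrite [row k _ 0 0]mxE mulNr.
  + move=> k l nz; have [Mz|/supM[h1 h2]] := eqVneq (M k l) 0; last first.
      rewrite !f7E // !f6E //= !f5E // !f4E //= !f2E //.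
      by split; case: ifP.
    move: nz; rewrite /M'; move: (M *m col j A - _) supc => c supc nz.
    have : c k 0 * h 0 l != 0.
      apply: contra nz => /eqP e.
      by rewrite !mxE Mz big_ord1 e mulr0 subr0.
    rewrite mulf_eq0 negb_or => /andP[/supc h1 /suph h2].
    by rewrite !f7E //; split=> //; rewrite f6E //= f5E.
- by rewrite W'E -rk (rank_elim Wij) addSnnS.
- move=> sep; have [Wg pg] := good sep.
  have [j' lj'] := lead_at_ex row_neq0.
  (* Separation makes every node above the leading column nonzero, so the search has found the pivot
     of [gauss]. *)
  have jj' : j = j'.
    apply: leadj; first by rewrite hW lead_atN.
    move=> l lL; rewrite hW node_sumN oppr_eq0 Wg.
    by apply: node_sum_pivot; rewrite -?Wg.
  rewrite W'E -[i.+1]/(i0.+1) (gauss_step (j := j)) -?Wg ?jj' //; split=> //.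
  rewrite (@pivots_ofS f _ _ i0 j).
  + by rewrite pg /val_pairs map_rcons jj'.
  + by move=> a k [] -> kr; rewrite /f7 !updE /= (ltn_eqF kr) f6f.
  + by rewrite /f7 !updE /= eqxx.
  + by rewrite /f7 !updE /= eqxx.
- apply: (leq_trans t6E).
  have c4 : (cnt (f4 6%N) m <= (cnt (f 6%N) m).+1)%N.
    by apply: (@cnt_set _ _ _ i) => k; rewrite f4E //= f2E.
  have e5 : cI5 = cnt (f4 6%N) m by apply: eq_bigr => k _; rewrite f5E.
  have e6 : cJ5 = cnt (f 7%N) n by apply: eq_bigr => k _; rewrite f5E // f4E //= f2E.
  rewrite e5 e6 -[cnt (f2 6%N) m]/(cnt (f 6%N) m) -[cnt (f2 7%N) n]/(cnt (f 7%N) n).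
  have := pivot_costS cI cJ; move: t2E c4.
  move: (cnt (f 6%N) m) (cnt (f4 6%N) m) (cnt (f 7%N) n) (pivot_cost r) (pivot_cost r.+1).
  move: (\sum_(a < _) _)%N => ns a a' b p p' t2E c4.
  have h1 : (L * (2 * a' + 1) <= L * (2 * a.+1 + 1))%N by rewrite leq_mul2l; apply/orP; right; lia.
  have h2 : (b * a' <= b * a.+1)%N by rewrite leq_mul2l c4 orbT.
  have h3 : (b.+1 * a' <= b.+1 * a.+1)%N by rewrite leq_mul2l c4 orbT.
  lia.
Qed.

End Rows.

End Elimination_run.

(** * Reading the input, powers of 2 and random choices *)

Section Preprocessing.
Variables (K : fieldType) (tape : nat -> K).
Local Notation run := (run tape).
Implicit Types (f : nat -> nat -> nat) (g : nat -> nat -> K).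

Definition ReadInput : cmd :=
  For 8 vs
    (FCopy 1 (NAdd (NMul (NGet 1 vu) vn) (NGet 2 vu)) 0 vu ;;
     NSet 3 (NAdd (NMul (NGet 1 vu) vn) (NGet 2 vu)) (NLit 1)).

(** Copies are not charged, so the count stays 0; cells outside the support are right because they
    are initially zero. *)
Lemma run_read_input m n (A : 'M[K]_(m, n)) (Q : state K -> Prop) :
  let s0 := init_state A in
  (forall f g,
    (forall a k : nat, a != 3%N -> a != 8%N -> f a k = nmem s0 a k) ->
    (forall a k : nat, a != 1%N -> g a k = fmem s0 a k) ->
    (forall (i : 'I_m) (j : 'I_n), f 3%N (i * n + j)%N = (A i j != 0)) ->
    rep_mx (g 1%N) A -> Q (State f g 0 0)) ->
  run ReadInput s0 Q.
Proof.
move=> s0 HQ; set s := enum (supp A).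
have size_s : size s = #|supp A| by rewrite -cardE.
apply: (@run_for _ _ _ _ _ #|supp A| (fun e st => exists f g,
  [/\ st = State f g 0 0 /\ f 8%N 0%N = e,
      forall a k : nat, a != 3%N -> a != 8%N -> f a k = nmem s0 a k,
      forall a k : nat, a != 1%N -> g a k = fmem s0 a k,
      forall (i : 'I_m) (j : 'I_n), f 3%N (i * n + j)%N = ((i, j) \in take e s) &
      forall (i : 'I_m) (j : 'I_n),
        g 1%N (i * n + j)%N = if (i, j) \in take e s then A i j else 0])).
- exists (upd (nmem s0) 8 0 0%N), (fmem s0); split=> //.
  + by move=> a k _ a8; rewrite updE (negPf a8).
  + by move=> i j; rewrite updE /= nth_nil take0.
  + by move=> i j; rewrite /= nth_nil take0.
- by move=> e st [f [g [[-> f8] fE _ _ _]]]; split=> //; rewrite /= fE.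
- move=> e st es [f [g [[-> f8] fE gE f3 g1]]].
  have [x0 _] : exists x0, x0 \in s.
    by case: (s) size_s => [|x0 s'] h; [rewrite -h in es | exists x0; rewrite inE eqxx].
  pose ij := nth x0 s e.
  have f1e : f 1%N e = ij.1 by rewrite fE //= (nth_map x0) ?size_s.
  have f2e : f 2%N e = ij.2 by rewrite fE //= (nth_map x0) ?size_s.
  have idx (i : 'I_m) (j : 'I_n) : (i * n + j == ij.1 * n + ij.2)%N = ((i, j) == ij).
    apply/eqP/eqP => [e2|<- //]; case: (ij) e2 => i' j' /= e2.
    have := congr1 (divn^~ n) e2; have := congr1 (modn^~ n) e2.
    by rewrite !divn_flat // !modn_flat // => /val_inj -> /val_inj ->.
  apply: run_seq; apply: run_fcopy; apply: run_nset.
  rewrite /= f8 f1e f2e !fE //=.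
  exists (upd (upd f 3 (ij.1 * n + ij.2) 1%N) 8 0 e.+1),
         (upd g 1 (ij.1 * n + ij.2) (g 0%N e)); split.
  + by split=> //; rewrite /setn /= !updE /= f8.
  + by move=> a k a3 a8; rewrite !updE (negPf a3) (negPf a8) /= fE.
  + by move=> a k a1; rewrite !updE (negPf a1) /= gE.
  + move=> i j; rewrite !updE /= idx (take_nth x0) ?size_s // mem_rcons inE -/ij.
    by case: eqP => //=; rewrite f3.
  + move=> i j; rewrite !updE /= idx (take_nth x0) ?size_s // mem_rcons inE -/ij.
    case: eqP => [e2|] //=.
    by rewrite gE //= (nth_map x0) ?size_s // -/ij -e2.
- move=> st [f [g [[-> f8] fE gE f3 g1]]].
  have mem_s i j : ((i, j) \in take #|supp A| s) = (A i j != 0).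
    by rewrite -size_s take_size mem_enum inE.
  apply: HQ => // [i j|i j]; first by rewrite f3 mem_s.
  by rewrite g1 mem_s; case: eqP.
Qed.

Definition Powers : cmd :=
  NSet 4 (NLit 0) (NLit 1) ;;
  While (NSub vn (NGet 4 vL))
    (NSet 4 (NAdd vL (NLit 1)) (NMul (NLit 2) (NGet 4 vL)) ;;
     NSet 5 (NLit 0) (NAdd vL (NLit 1))).

Lemma run_powers n f g t q Q :
  f 0%N 1%N = n -> f 5%N 0%N = 0%N ->
  (forall f',
    (forall a k : nat, a != 4%N -> a != 5%N -> f' a k = f a k) ->
    f' 5%N 0%N = up_log 2 n ->
    (forall l, (l <= up_log 2 n)%N -> f' 4%N l = (2 ^ l)%N) ->
    Q (State f' g t q)) ->
  run Powers (State f g t q) Q.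
Proof.
move=> fn f5 HQ; set U := up_log 2 n in HQ.
apply: run_seq; apply: run_nset.
apply: (@run_while _ _ _ _ U (fun k s => exists f',
  [/\ s = State f' g t q, (k <= U)%N,
      forall a k : nat, a != 4%N -> a != 5%N -> f' a k = f a k,
      f' 5%N 0%N = (U - k)%N &
      forall l, (l <= U - k)%N -> f' 4%N l = (2 ^ l)%N])).
- eexists; split; first reflexivity => //.
  + by [].
  + by move=> a k a4 a5; rewrite updE (negPf a4).
  + by rewrite updE /= subnn.
  + by move=> l; rewrite subnn leqn0 => /eqP ->; rewrite updE.
- move=> k s [f' [-> kU f'E f'5 f'4]].
  have lt : (2 ^ (U - k.+1) < n)%N.
    by rewrite ltnNge; apply/negP => /(@up_log_min 2 _ _ (erefl _)); rewrite -/U; lia.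
  split; first by rewrite /= f'5 f'4 // f'E //= fn; lia.
  apply: run_seq; apply: run_nset; apply: run_nset; eexists; split; first reflexivity.
  + exact: ltnW.
  + by move=> a l a4 a5; rewrite !updE (negPf a4) (negPf a5) f'E.
  + by rewrite /= !updE /= f'5; lia.
  + move=> l lU; rewrite /= !updE /= f'5; case: eqP => [->|ne].
      by rewrite f'4 // addn1 expnS.
    by apply: f'4; lia.
- move=> s [f' [-> _ f'E f'5 f'4]]; rewrite subn0 in f'5 f'4; split; last exact: HQ.
  by rewrite /= f'5 f'4 // f'E //= fn; apply/eqP; rewrite subn_eq0 up_logP.
Qed.

Definition Sample : cmd := For 8 vn (FSample 2 vu).

Lemma run_sample n f g Q :
  f 0%N 1%N = n ->
  (forall f' g',
    (forall a k : nat, a != 8%N -> f' a k = f a k) ->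
    (forall a k : nat, a != 2%N -> g' a k = g a k) ->
    (forall k : 'I_n, g' 2%N k = tape k) -> Q (State f' g' n n)) ->
  run Sample (State f g 0 0) Q.
Proof.
move=> fn HQ; apply: (@run_for _ _ _ _ _ n (fun e s => exists f' g',
  [/\ s = State f' g' e e /\ f' 8%N 0%N = e,
    forall a k : nat, a != 8%N -> f' a k = f a k,
    forall a k : nat, a != 2%N -> g' a k = g a k &
    forall k, (k < e)%N -> g' 2%N k = tape k])).
- by do 2!eexists; split=> //= a k a8; rewrite updE (negPf a8).
- by move=> e s [f' [g' [[-> f8] fE _ _]]]; split=> //; rewrite /= fE.
- move=> e s en [f' [g' [[-> f8] fE gE g2]]]; apply: run_fsample.
  do 2!eexists; split; first (split; first reflexivity).
  + by rewrite /= !updE /= f8.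
  + by move=> a k a8; rewrite !updE (negPf a8) /= fE.
  + by move=> a k a2; rewrite /= !updE (negPf a2) /= gE.
  + move=> k; rewrite ltnS leq_eqVlt => /predU1P[->|ke]; rewrite /= updE /= f8 ?eqxx //.
    by rewrite (ltn_eqF ke) g2.
- by move=> s [f' [g' [[-> f8] fE gE g2]]]; apply: HQ => // k; apply: g2.
Qed.

End Preprocessing.

(** * The table of dyadic sums and the complete run *)

Section Whole_run.
Variables (K : fieldType) (tape : nat -> K).
Local Notation run := (run tape).
Implicit Types (f : nat -> nat -> nat) (g : nat -> nat -> K).

(** The outer counter packs row [a], level [l] and block [b] as [(a * (L + 1) + l) * n + b]; this
    and the next two expressions recover them. *)
Definition tree_row : nexp := NDiv (NDiv vu vn) (NAdd vL (NLit 1)).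
Definition tree_level : nexp := NSub (NDiv vu vn) (NMul tree_row (NAdd vL (NLit 1))).
Definition tree_block : nexp := NSub vu (NMul (NDiv vu vn) vn).
(** With truncated subtraction, [1 - ((q - b) + (b - q))] is nonzero only if [q = b]. The guard
    selects the nonzero entries of the row in one dyadic block. *)
Definition tree_guard : nexp :=
  let q := NDiv vv (NGet 4 tree_level) in
  NMul (flagA (NAdd (NMul tree_row vn) vv))
    (NSub (NLit 1) (NAdd (NSub q tree_block) (NSub tree_block q))).

Definition Tree : cmd :=
  Dots (NMul (NMul vm (NAdd vL (NLit 1))) vn) vn tree_guard
    3 1 (NAdd (NMul tree_row vn) vv) 2 vv.

Lemma eq_subn a b : ((1 - ((a - b) + (b - a)))%N != 0%N) = (a == b).
Proof. by apply/idP/eqP => h; lia. Qed.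

(** At each level a column belongs to a single block, so a nonzero entry of [A] passes the guard at
    most [L + 1] times. *)
Lemma run_tree m n (A : 'M[K]_(m, n)) (x : nat -> K) L f g t q Q :
  f 0%N 0%N = m -> f 0%N 1%N = n -> f 5%N 0%N = L ->
  (forall l, (l <= L)%N -> f 4%N l = (2 ^ l)%N) ->
  (forall (i : 'I_m) (j : 'I_n), f 3%N (i * n + j)%N = (A i j != 0)) ->
  rep_mx (g 1%N) A -> (forall k : 'I_n, g 2%N k = x k) ->
  (forall f' g' t',
    (forall a k : nat, a != 8%N -> a != 9%N -> f' a k = f a k) ->
    (forall a k : nat, a != 3%N -> a != 10%N -> g' a k = g a k) ->
    (forall (a : 'I_m) l b, (l <= L)%N -> (b < n)%N ->
       g' 3%N ((a * (L + 1) + l) * n + b)%N = node_sum (row a A) x l b) ->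
    (t' <= t + 2 * (L.+1 * \sum_(a < m) row_nnz A a))%N ->
    Q (State f' g' t' q)) ->
  run Tree (State f g t q) Q.
Proof.
move=> fm fn fL f4 f3 gA gx HQ.
apply: (@run_dots _ _ _ _ _ _ _ _ _ _ _ _ _ _ (m * (L + 1) * n)%N n) => //.
  by move=> a b; rewrite /= /setuv !updE /= fm fn fL.
move=> g' y hg'.
have guardE (a : 'I_m) l b (v : 'I_n) : (l <= L)%N -> (b < n)%N ->
    (neval (setuv f ((a * (L + 1) + l) * n + b) v) tree_guard != 0%N)
    = (A a v != 0) && (v %/ 2 ^ l == b)%N.
  move=> lL bn; have lL1 : (l < L + 1)%N by rewrite addn1.
  rewrite /= /setuv !updE /= fn fL !divn_flat // !addKn f4 // f3.
  by rewrite muln_eq0 negb_or eq_subn eqb0 negbK.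
apply: HQ.
- by move=> a k a8 a9; rewrite /setuv !updE (negPf a8) (negPf a9).
- by move=> a k a3 a10; rewrite hg' // (negPf a3).
- move=> a l b lL bn; rewrite hg' //= ltn_flat ?ltn_flat ?addn1 ?ltnS //=.
  rewrite /node_sum [RHS]big_mkcond; apply: eq_bigr => v _.
  rewrite -addn1 guardE // /setuv !updE /= fn fL !divn_flat ?addn1 // gA gx mxE.
  have [->|_] := eqVneq (A a v) 0; first by case: ifP; rewrite mul0r //; case: ifP.
  by [].
rewrite leq_add2l leq_mul2l /=.
pose G u v := neval (setuv f u v) tree_guard.
have -> : (\sum_(u < m * (L + 1) * n) \sum_(v < n) (G u v != 0) =
    \sum_(p < m * (L + 1)) \sum_(b < n) \sum_(v < n) (G (p * n + b) v != 0))%N.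
  rewrite -(sum_flat _ _ (fun p b => \sum_(v < n) (G (p * n + b) v != 0))%N).
  by apply: eq_bigr => u _; rewrite -divn_eq.
have -> : (\sum_(p < m * (L + 1)) \sum_(b < n) \sum_(v < n) (G (p * n + b) v != 0) =
    \sum_(a < m) \sum_(l < L + 1) \sum_(b < n) \sum_(v < n)
      (G ((a * (L + 1) + l) * n + b) v != 0))%N.
  rewrite -(sum_flat _ _ (fun a l => \sum_(b < n) \sum_(v < n)
    (G ((a * (L + 1) + l) * n + b) v != 0))%N).
  by apply: eq_bigr => p _; rewrite -divn_eq.
rewrite big_distrr; apply: leq_sum => a _ /=.
apply: (@leq_trans (\sum_(l < L + 1) row_nnz A a)%N); last first.
  by rewrite sum_nat_const card_ord addn1.
apply: leq_sum => l _.
rewrite exchange_big /row_nnz; apply: leq_sum => v _ /=; rewrite valK.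
rewrite (eq_bigr (fun b : 'I_n => ((A a v != 0)%R && (v %/ 2 ^ l == b)%N : nat))); last first.
  by move=> b _; rewrite /G guardE //; have := ltn_ord l; rewrite {2}addn1 ltnS.
case: (A a v != 0)%R; last by rewrite big1.
case: (ltnP (v %/ 2 ^ l) n) => [lt|ge].
  rewrite (bigD1 (Ordinal lt)) //= eqxx big1 // => b /negPf nb.
  by rewrite -(inj_eq val_inj) /= eq_sym in nb; rewrite nb.
by rewrite big1 // => b _; case: eqP => // e; move: ge; rewrite e leqNgt ltn_ord.
Qed.

Definition Main : cmd :=
  ReadInput ;; NSet 0 (NLit 2) (NLit 0) ;; Sample ;; Powers ;; Tree ;;
  FConst 13 (NLit 0) true ;; For 10 vm Row.

Lemma sum_row_nnz m n (A : 'M[K]_(m, n)) : (\sum_(a < m) row_nnz A a = #|supp A|)%N.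
Proof.
rewrite -sum1_card (eq_bigl (fun ij : 'I_m * 'I_n => A ij.1 ij.2 != 0)); last first.
  by move=> ij; rewrite inE.
rewrite [RHS]big_mkcond -(pair_bigA _ (fun i j => if A i j != 0 then 1%N else 0%N)) /=.
by apply: eq_bigr => a _; apply: eq_bigr => k _; rewrite valK; case: (_ != _).
Qed.

Lemma output_pivots m n (A : 'M[K]_(m, n)) (s : state K) p :
  pivots_of (nmem s) (nmem s 0%N 2%N) = val_pairs p -> output m n s = pivot_mx K p.
Proof.
move=> h; apply/matrixP => i j; rewrite !mxE; congr (nat_of_bool _)%:R.
have inj : injective (fun ij : 'I_m * 'I_n => (val ij.1, val ij.2)).
  by move=> [a b] [c d] /= [/val_inj -> /val_inj ->].
have -> : ((i, j) \in p) = ((val i, val j) \in val_pairs p) by rewrite -(mem_map inj).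
rewrite -h -has_pred1 /pivots_of has_map; apply: eq_has => k /=.
by rewrite xpair_eqE.
Qed.

Lemma total_costE d r3 R3 r2 R2 m n c t t' : (0 < d)%N ->
  (r3 <= R3)%N -> (d * r2 <= d * R2)%N ->
  (t <= t' + 2 * (m + c) + (2 * r3 + 9 * d * r2))%N -> (t' <= n + 2 * (d * c))%N ->
  (t <= 2 * R3 + 9 * d * (R2 + m + n + c))%N.
Proof.
move=> d0 h3 h2 ht ht'.
have hm : (m <= d * m)%N by rewrite leq_pmull.
have hn : (n <= d * n)%N by rewrite leq_pmull.
have hc : (c <= d * c)%N by rewrite leq_pmull.
rewrite -mulnA !mulnDr; rewrite -mulnA in ht; lia.
Qed.

Lemma run_main m n (A : 'M[K]_(m, n)) : (0 < m)%N -> (0 < n)%N ->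
  run Main (init_state A) (fun s =>
    [/\ nsmp s = n,
      (nops s <= 2 * \rank A ^ 3 + 9 * (1 + up_log 2 n) * (\rank A ^ 2 + m + n + #|supp A|))%N &
      separating A tape (up_log 2 n) -> output m n s = pivot_mx K (gauss A m).2]).
Proof.
move=> m0 n0; set L := up_log 2 n.
apply: run_seq; apply: run_read_input => f1 g1 f1E g1E f1A g1A.
apply: run_seq; apply: run_nset; rewrite /=.
apply: run_seq; apply: (@run_sample _ _ n); first by rewrite updE /= f1E.
move=> f2 g2 f2E g2E g2x.
apply: run_seq; apply: (@run_powers _ _ n); rewrite ?f2E ?updE /= ?f1E //.
move=> f3 f3E f35 f34; rewrite -/L in f35 f34.
have f31 (a k : nat) : a \notin [:: 0; 4; 5; 8]%N -> f3 a k = f1 a k.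
  rewrite !inE !negb_or => /and4P[a0 a4 a5 a8].
  by rewrite f3E // f2E // updE (negPf a0).
have f30 (k : nat) : f3 0%N k = if k == 2%N then 0%N else f1 0%N k.
  by rewrite f3E // f2E // updE.
apply: run_seq; apply: (@run_tree m n A tape L); rewrite ?f30 ?f1E //.
- by move=> i j; rewrite f31.
- by move=> i j; rewrite g2E.
move=> f4 g4 t4 f4E g4E g4D t4E.
apply: run_seq; apply: run_fconst => /=.
have f41 (a k : nat) : a \notin [:: 0; 4; 5; 8; 9]%N -> f4 a k = f1 a k.
  rewrite !inE !negb_or => /and5P[a0 a4 a5 a8 a9].
  by rewrite f4E // f31 // !inE !negb_or a0 a4 a5 a8.
have g41 (a k : nat) : a \notin [:: 2; 3; 10]%N -> g4 a k = g1 a k.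
  by rewrite !inE !negb_or => /and3P[a2 a3 a10]; rewrite g4E // g2E.
apply: (@run_for _ _ _ _ _ m (row_inv A tape L t4 n)).
(* Initially [M] is zero, so [W] is [A]; no pivot is known and nothing is flagged. *)
- exists (upd f4 10 0 0), (upd g4 13 0 1), t4, 0%N, 0; split; split=> //.
  + split; first split.
    * by rewrite updE /= f4E // f30 f1E.
    * by rewrite updE /= f4E // f30 f1E.
    * by rewrite updE /= f4E.
    * by move=> i j; rewrite updE /= f41 // f1A.
    by split=> // i j; rewrite updE /= g41.
  + by split=> //; rewrite updE /= f4E // f30.
  + split.
    * by move=> i j; rewrite updE /= g41 // g1E //= nth_nil mxE.
    * move=> k; rewrite updE /= g41 // g1E //= nth_nil mul0mx row0 /node_sum big1 // => j _.
      by rewrite mxE mul0r.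
    * by move=> k l; rewrite mxE eqxx.
    * by rewrite leqn0 /cnt big1 // => k _; rewrite updE /= f41 // f1E //= nth_nil.
    * by rewrite leqn0 /cnt big1 // => k _; rewrite updE /= f41 // f1E //= nth_nil.
  + by rewrite mulmx0 mul0mx subr0 addn0.
  + by move=> _; rewrite mulmx0 mul0mx subr0.
  + by rewrite big_ord0 /pivot_cost; lia.
- by move=> i s [f [g [t [r [M [[-> [[fm _ _ _] _] [fi _] _] _]]]]]].
- by move=> i s im; apply: run_row => //; apply: up_logP.
move=> s [f [g [t [r [M [[-> _ [_ fr] _] [rk good cost]]]]]]]; split=> //=.
- have {}rk : (r <= \rank A)%N by rewrite -rk leq_addl.
  move: cost t4E; rewrite sum_row_nnz /pivot_cost => cost t4E.
  have h3 : (r ^ 3 <= \rank A ^ 3)%N by rewrite leq_exp2r.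
  have h2 : (L.+1 * r ^ 2 <= L.+1 * \rank A ^ 2)%N by rewrite leq_mul2l leq_exp2r ?rk ?orbT.
  exact: (total_costE (ltn0Sn L) h3 h2 cost t4E).
- by move=> /good[_ pE]; apply: (output_pivots A); rewrite /= fr.
Qed.

End Whole_run.

(** * Running time and probability *)

Local Open Scope classical_set_scope.
Local Open Scope ring_scope.

Section Exponent.
Variable R : realType.

Lemma up_log2_le_ln N : (2 <= up_log 2 N)%N ->
  (up_log 2 N)%:R * ln 2 <= 2 * ln N%:R :> R.
Proof.
set u := up_log 2 N => hu.
have lt : (2 ^ u.-1 < N)%N.
  apply: up_log_gtn => //; rewrite ltnNge; apply: contraL hu => N1.
  by rewrite -leqNgt /u leqW // leqn0 up_log_eq0 N1 orbT.
have l2 : 0 <= ln 2 :> R by rewrite ln_ge0 // ler1n.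
have : u.-1%:R * ln 2 <= ln N%:R :> R.
  rewrite mulr_natl -lnXn ?ltr0n // -natrX ler_ln ?posrE ?ltr0n ?expn_gt0 ?(leq_ltn_trans _ lt) //.
  by rewrite ler_nat ltnW.
have : u%:R <= 2 * u.-1%:R :> R by rewrite -natrM ler_nat; lia.
move: (ln 2) (ln N%:R) l2 => a b l2; nra.
Qed.

(** For [N > 1], raising [N] to this power gives [c * (1 + up_log 2 N)], so a logarithmic factor
    becomes part of the exponent. The case [N <= 1] is set apart because [ln N] is not positive
    there. *)
Definition exponent (c N : nat) : R :=
  if (N <= 1)%N then 0 else ln (c * (1 + up_log 2 N))%:R / ln N%:R.

Lemma le_powR_exponent c N : (0 < c)%N -> (1 < N)%N ->
  (c * (1 + up_log 2 N) * N)%:R <= N%:R `^ (1 + exponent c N) :> R.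
Proof.
move=> c0 N1; rewrite /exponent leqNgt N1 /=.
have N0 : (0 < N%:R :> R) by rewrite ltr0n; lia.
have lnN : 0 < ln N%:R :> R by rewrite ln_gt0 // ltr1n.
rewrite /powR (gt_eqF N0) mulrDl mul1r divfK ?gt_eqF // expRD !lnK ?posrE ?ltr0n //.
  by rewrite natrM mulrC.
- by rewrite muln_gt0 c0.
- exact: ltnW.
Qed.

(** With [u = up_log 2 N], the claim is [c * (1 + u) <= expR (e * ln N)] for large [N]. As [ln N] is
    at least [u * ln 2 / 2], it follows from [expR y >= 1 + y ^ 2 / 2] at [y = e' * u]. *)
Lemma cvg_exponent c : (0 < c)%N -> exponent c @ \oo --> (0 : R).
Proof.
move=> c0; apply/cvgrPdist_le => e e0.
have l2 : 0 < ln 2 :> R by rewrite ln_gt0 // ltr1n.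
pose e' := e * ln 2 / 2; have e'0 : 0 < e' by rewrite /e' !mulr_gt0.
(* Past [U], [e' ^ 2 * u] is at least [8 * c], so the quadratic term dominates [c * (1 + u)]. *)
pose U := Num.truncn (8 * c%:R / e' ^+ 2).
near=> N.
have hu : (U.+2 <= up_log 2 N)%N.
  rewrite ltnNge; apply/negP => h.
  have : (N <= 2 ^ U.+2)%N by apply: (leq_trans (@up_logP 2 N _)) => //; rewrite leq_exp2l //; lia.
  apply/negP; rewrite -ltnNge; near: N; exact: nbhs_infty_gt.
have N1 : (1 < N)%N by near: N; exact: nbhs_infty_gt.
have lnN : 0 < ln N%:R :> R by rewrite ln_gt0 // ltr1n.
rewrite /exponent leqNgt N1 /=; set u := up_log 2 N in hu *.
have cu0 : (0 < c * (1 + u))%N by rewrite muln_gt0 c0.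
rewrite sub0r normrN ger0_norm; last first.
  by apply: divr_ge0; [apply: ln_ge0; rewrite ler1n | exact: ltW].
rewrite ler_pdivrMr //.
apply: (@le_trans _ _ (e' * u%:R)); last first.
  have := @up_log2_le_ln N (leq_trans _ hu); rewrite -/u => /(_ isT) h.
  by rewrite /e'; nra.
rewrite -ler_expR lnK ?posrE ?ltr0n //.
apply: le_trans (expR_ge1Dxn 1 (mulr_ge0 (ltW e'0) (ler0n _ _))).
have hU : 8 * c%:R <= e' ^+ 2 * u%:R.
  rewrite -ler_pdivrMl ?exprn_gt0 // mulrC ltW // (lt_le_trans (truncnS_gt _)) //.
  by rewrite ler_nat -/U ltnW.
have u1 : 1 <= u%:R :> R by rewrite ler1n; lia.
have c1 : 0 <= c%:R :> R by [].
rewrite natrM natrD exprMn (_ : 2`!%:R = 2 :> R) //.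
move: (e' ^+ 2) (u%:R : R) (c%:R : R) hU u1 c1 => a v b h v1 b0; nra.
Unshelve. all: by end_near.
Qed.

End Exponent.

(** The hypothesis on [T] and [size S] makes the set of tapes nonempty, so that the quotient in
    [monte_carlo] is a genuine probability. *)
Lemma monte_carlo_half (R : realType) P (K : fieldType) (S : seq K) m n
    (A : 'M[K]_(m, n)) correct (bound : R) T (G : {set T.-tuple 'I_(size S)}) :
  (T = 0 \/ 0 < size S)%N ->
  (#|{: T.-tuple 'I_(size S)}| <= 2 * #|G|)%N ->
  (forall w : T.-tuple 'I_(size S), run (tape_of w) P (init_state A) (fun s =>
     [/\ (nsmp s <= T)%N, (nops s)%:R <= bound & w \in G -> correct (output m n s)])) ->
  monte_carlo P (2^-1 : R) S A correct bound.
Proof.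
move=> T0 hG h; exists T; split.
  by move=> w; have [s e [h1 h2 _]] := h w; exists s.
have tot : (0 < #|{: T.-tuple 'I_(size S)}|)%N.
  by rewrite card_tuple card_ord; case: T0 => [->//|S0]; rewrite expn_gt0 S0.
rewrite ler_pdivlMr ?ltr0n // ler_pdivrMl // -natrM ler_nat.
apply: (leq_trans hG); rewrite leq_mul2l /=; apply/subset_leq_card/fintype.subsetP => w wG.
by rewrite inE; apply/asboolP; have [s e [_ _ h3]] := h w; exists s; split; last exact: h3.
Qed.

Theorem corollary33 (R : realType) :
  exists (P : cmd) (delta : R) (eps : nat -> R),
    [/\ 0 < delta,
        eps @ \oo --> (0 : R)
      & forall (K : fieldType) (m n : nat) (A : 'M[K]_(m, n)) (S : seq K),
          uniq S ->
          (2 * minn m n * (1 + up_log 2 m + up_log 2 n) <= size S)%N ->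
          let r := \rank A in
          let N := (r ^ 2 + m + n + #|supp A|)%N in
          monte_carlo P delta S A (is_rank_profile_matrix A)
            (2 * r%:R ^+ 3 + N%:R `^ (1 + eps N))].
Proof.
(* The test diverts matrices without entries; 9 is the constant in the cost of [run_main]. *)
exists (NIf (NMul vm vn) Main Skip), 2^-1, (exponent R 9); split => //.
  exact: cvg_exponent.
move=> K m n A S uS hS r N.
have [mn0|] := posnP (m * n)%N.
  (* [S] may be empty here; with [T = 0] there is still exactly one tape. *)
  apply: (@monte_carlo_half _ _ _ _ _ _ _ _ _ 0 finset.setT); first by left.
    by rewrite cardsT leq_pmull.
  move=> w; apply: run_nif; rewrite /= mn0 /=; apply: run_skip; split=> //=.
    by rewrite addr_ge0 ?powR_ge0 // mulr_ge0 // exprn_ge0.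
  move=> _; rewrite (_ : output _ _ _ = pivot_mx K (gauss A m).2); first exact: gauss_rank_profile.
  apply/matrixP => i j; have := muln_gt0 m n.
  by rewrite mn0 (leq_ltn_trans _ (ltn_ord i)) // (leq_ltn_trans _ (ltn_ord j)).
rewrite muln_gt0 => /andP[m0 n0].
have r_min : (r <= minn m n)%N by rewrite leq_min rank_leq_row rank_leq_col.
apply: (@monte_carlo_half _ _ _ _ _ _ _ _ _ n
  [set w : n.-tuple 'I_(size S) | separating A (tape_of w) (up_log 2 n)]%SET).
- by right; apply: leq_trans hS; rewrite !muln_gt0 leq_min m0 n0.
(* The rank is at most [minn m n], so [S] has at least twice as many elements as there are sums to
   keep nonzero. *)
- apply: card_separating => //; apply: leq_trans hS; rewrite -mulnA leq_mul2l /=.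
  by apply: leq_mul => //; lia.
move=> w; apply: run_nif; rewrite /= muln_eq0 negb_or -!lt0n m0 n0 /=.
apply: run_weaken (run_main (tape_of w) A m0 n0) => s [-> cost good]; split=> //.
  have N1 : (1 < N)%N by rewrite /N; lia.
  (* Since [n <= N], the depth of the tree can be bounded in terms of [N] alone, as [exponent]
     requires. *)
  rewrite -natrX -natrM; apply: (@le_trans _ _ (2 * r ^ 3 + 9 * (1 + up_log 2 N) * N)%N%:R).
    rewrite ler_nat (leq_trans cost) // leq_add2l leq_mul2r leq_mul2l leq_add2l.
    by rewrite leq_up_log ?orbT // /N; lia.
  by rewrite natrD lerD2l le_powR_exponent.
by rewrite inE => /good ->; apply: gauss_rank_profile.
Qed.
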